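(* Consider a Young tower $T:X\to X$ with invariant probability measure $\mu$ such that $\mathrm{tail}_n\sim C n^{-q}$ for some $q>1$ and some constant $C>0$. Let $a_n=n^{1/2}$ if $q>2$, $a_n=(n\log n)^{1/2}$ if $q=2$, and $a_n=n^{1/q}$ if $q\in(1,2)$. Let $f:X\to\mathbb{R}$ be a Lipschitz function with $\int f\,d\mu=0$ such that $a_n^{-1}S_nf$ (on the probability space $(X,\mu)$) converges in distribution to a nondegenerate random variable $Z$, which is Gaussian if $q\ge2$ and a stable law of index $q$ if $q\in(1,2)$; here $S_nf=\sum_{i=0}^{n-1}f\circ T^i$. Then $$\int |a_n^{-1}S_nf|^p\,d\mu\to \mathbb{E}(|Z|^p)\qquad\text{for all } 0<p<p^*,$$ where $p^*=2q-2$ for $q\ge2$ and $p^*=q$ for $q\in(1,2)$. In particular, there exist nonzero constants $C=C_{p,q}$ (for the given $f$) such that: - if $q>2$, then $\int|S_nf|^p\,d\mu\sim C n^{p/2}$ for all $p<2q-2$; - if $q=2$, then $\int|S_nf|^p\,d\mu\sim C (n\log n)^{p/2}$ for all $p<2$; - if $q\in(1,2)$, then $\int|S_nf|^p\,d\mu\sim C n^{p/q}$ for all $p<q$.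
   Context: A Young tower is a space $X$ with a partition $X=\bigcup_\alpha\bigcup_{0\le i<h_\alpha}\Delta_{\alpha,i}$ ($\alpha$ in a countable set, $h_\alpha$ positive integers), an ergodic probability measure $\mu$ and a map $T:X\to X$ preserving $\mu$. $T$ maps $\Delta_{\alpha,i}$ bijectively to $\Delta_{\alpha,i+1}$ if $i+1<h_\alpha$, and maps $\Delta_{\alpha,h_\alpha-1}$ bijectively to the basis $\Delta_0=\bigcup_\alpha\Delta_{\alpha,0}$. The distance is $d(x,y)=\rho^{s(x,y)}$, where $\rho\in(0,1)$ is fixed and the separation time $s(x,y)$ is the number of returns to the basis before the iterates of $x$ and $y$ are not in the same partition element. Denoting by $g$ the inverse of the jacobian of $T$ with respect to $\mu$, one assumes that there is a constant $C$ with $|\log g(x)-\log g(y)|\le C\,d(Tx,Ty)$ for all $x,y$ in the same partition element. The return time $\phi:\Delta_0\to\mathbb{N}$ is $\phi=h_\alpha$ on $\Delta_{\alpha,0}$, and $\mathrm{tail}_n=\mu\{x\in\Delta_0:\phi(x)\ge n\}$. The Lipschitz norm of $f:X\to\mathbb{R}$ is $\|f\|=\sup_x|f(x)|+\sup_{x,y}|f(x)-f(y)|/d(x,y)$, the second supremum being over pairs $x\neq y$ in the same partition element; $f$ is Lipschitz if $\|f\|<\infty$. The notation $u_n\sim v_n$ means $u_n/v_n\to1$. *)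

(* Defs.v *)
From HB Require Import structures.
From mathcomp Require Import all_boot all_order all_algebra.
From mathcomp Require Import finmap.
From mathcomp Require Import all_classical all_reals all_analysis.

Set Implicit Arguments.
Unset Strict Implicit.
Unset Printing Implicit Defensive.

Import Order.TTheory GRing.Theory Num.Theory.
Import numFieldNormedType.Exports.

Local Open Scope classical_set_scope.
Local Open Scope ring_scope.

(* Only the levels [level a i] with [i < height a] are part of the tower. *)
Record tower (X : Type) := Tower {
  tmap :> X -> X ;
  tidx : countType ;
  height : tidx -> nat ;
  level : tidx -> nat -> set X }.

Definition base (X : Type) (T : tower X) : set X :=
  \bigcup_(a in [set: tidx T]) level a 0.

Definition same_level (X : Type) (T : tower X) (x y : X) : Prop :=
  exists a i, [/\ (i < @height X T a)%N, level a i x & level a i y].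

(* The times k >= 1 at which x is in the base, k being before the separation of
   the orbits of x and y. *)
Definition joint_returns (X : Type) (T : tower X) (x y : X) : set nat :=
  [set k | [/\ (0 < k)%N, base T (iter k T x) &
    forall j, (j <= k)%N -> same_level T (iter j T x) (iter j T y)]].

(* rho ^ s(x, y), where the separation time s(x, y) is the number of elements of
   [joint_returns T x y], with the convention rho ^ oo = 0. *)
Definition tdist (R : realType) (X : Type) (T : tower X) (rho : R) (x y : X) : R :=
  if `[< finite_set (joint_returns T x y) >]
  then rho ^+ #|` fset_set (joint_returns T x y)| else 0.

Definition measure_preserving (R : realType) (d : measure_display)
    (X : measurableType d) (mu : probability X R) (T : X -> X) : Prop :=
  measurable_fun setT T /\
  forall A, measurable A -> mu (T @^-1` A) = mu A.

Definition ergodic (R : realType) (d : measure_display)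
    (X : measurableType d) (mu : probability X R) (T : X -> X) : Prop :=
  forall A, measurable A -> T @^-1` A = A -> mu A = 0%E \/ mu A = 1%E.

(* J is the jacobian of T with respect to mu: on each partition element, T is a
   bijection onto its image along which mu is transported with density J. *)
Definition is_jacobian (R : realType) (d : measure_display)
    (X : measurableType d) (mu : probability X R) (T : tower X) (J : X -> R) : Prop :=
  [/\ measurable_fun setT J, forall x, 0 < J x &
    forall a i A, (i < height a)%N -> measurable A -> A `<=` @level X T a i ->
      mu (T @` A) = (\int[mu]_(x in A) (J x)%:E)%E].

Record young_tower (R : realType) (d : measure_display) (X : measurableType d)
    (mu : probability X R) (T : tower X) (rho : R) : Prop := YoungTower {
  yt_height : forall a : tidx T, (0 < height a)%N ;
  yt_partition : partition [set ai : tidx T * nat | (ai.2 < height ai.1)%N]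
    (fun ai => level ai.1 ai.2) [set: X] ;
  yt_measurable : forall (a : tidx T) i, (i < height a)%N ->
    measurable (level a i) ;
  yt_climb : forall (a : tidx T) i, (i.+1 < height a)%N ->
    set_bij (level a i) (level a i.+1) T ;
  yt_return : forall a : tidx T,
    set_bij (level a (height a).-1) (base T) T ;
  yt_bimeasurable : forall (a : tidx T) i A, (i < height a)%N ->
    measurable A -> A `<=` level a i -> measurable (T @` A) ;
  yt_preserving : measure_preserving mu T ;
  yt_ergodic : ergodic mu T ;
  yt_rho : 0 < rho < 1 ;
  (* [tdist T rho] is a distance: distinct points are eventually separated. *)
  yt_separation : forall x y : X, x <> y ->
    exists n, ~ same_level T (iter n T x) (iter n T y) ;
  yt_distortion : exists2 J, is_jacobian mu T J &
    let g x := (J x)^-1 in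
    exists C, forall x y, same_level T x y ->
      `|ln (g x) - ln (g y)| <= C * tdist T rho (T x) (T y) }.

(* The return time is [height a] on [level a 0]. *)
Definition tail (R : realType) (d : measure_display) (X : measurableType d)
    (mu : probability X R) (T : tower X) (n : nat) : R :=
  fine (mu [set x | exists2 a : tidx T, level a 0 x & (n <= height a)%N]).

(* 0 is added to the second set so that the supremum over an empty set of pairs
   is 0 rather than -oo. *)
Definition lip_norm (R : realType) (X : Type) (T : tower X) (rho : R)
    (f : X -> R) : \bar R :=
  (ereal_sup [set `|f x|%:E | x in [set: X]] +
   ereal_sup (0 |` [set (`|f xy.1 - f xy.2| / tdist T rho xy.1 xy.2)%:E |
     xy in [set xy : X * X | xy.1 <> xy.2 /\ same_level T xy.1 xy.2]]))%E.

Definition lipschitz_fun (R : realType) (X : Type) (T : tower X) (rho : R)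
    (f : X -> R) : Prop := (lip_norm T rho f < +oo)%E.

Definition birkhoff_sum (R : realType) (X : Type) (T : X -> X) (f : X -> R)
    (n : nat) (x : X) : R := \sum_(i < n) f (iter i T x).

Definition asymp_equiv (R : realType) (u v : nat -> R) : Prop :=
  (fun n => u n / v n) @ \oo --> (1 : R).

Definition cvg_in_distribution (R : realType) (d d' : measure_display)
    (X : measurableType d) (P : probability X R) (Y : nat -> X -> R)
    (Om : measurableType d') (Q : probability Om R) (Z : {RV Q >-> R}) : Prop :=
  forall g : R -> R, continuous g -> (exists M : R, forall x, `|g x| <= M) ->
    ('E_P[g \o Y n] @[n --> \oo] --> 'E_Q[g \o Z])%E.

Definition nondegenerate_rv (R : realType) (d : measure_display)
    (Om : measurableType d) (Q : probability Om R) (Z : {RV Q >-> R}) : Prop :=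
  ~ exists c, distribution Q Z [set c] = 1%E.

Definition gaussian (R : realType) (d : measure_display)
    (Om : measurableType d) (Q : probability Om R) (Z : {RV Q >-> R}) : Prop :=
  exists m s : R, 0 < s /\
    forall B, measurable B -> distribution Q Z B = normal_prob m s B.

(* Stability: if Z1, Z2 are independent copies of Z then, for all a, b > 0,
   a Z1 + b Z2 has the law of c Z + e for some c > 0 and e; the law has index
   alpha if c ^ alpha = a ^ alpha + b ^ alpha. *)
Definition stable_law (R : realType) (alpha : R) (d : measure_display)
    (Om : measurableType d) (Q : probability Om R) (Z : {RV Q >-> R}) : Prop :=
  forall a b : R, 0 < a -> 0 < b -> exists c e : R,
    [/\ 0 < c, c `^ alpha = a `^ alpha + b `^ alpha &
      forall B : set R, measurable B ->
        (distribution Q Z \x distribution Q Z)%E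
          [set xy : R * R | B (a * xy.1 + b * xy.2)] =
        distribution Q Z [set x | B (c * x + e)]].

Definition normalization (R : realType) (q : R) (n : nat) : R :=
  if 2 < q then n%:R `^ 2^-1
  else if q == 2 then (n%:R * ln n%:R) `^ 2^-1
  else n%:R `^ q^-1.

Definition critical_exponent (R : realType) (q : R) : R :=
  if 2 <= q then 2 * q - 2 else q.

(* Main.v *)
Require Import Defs.
From HB Require Import structures.
From mathcomp Require Import all_boot all_order all_algebra.
From mathcomp Require Import finmap.
From mathcomp Require Import all_classical all_reals all_analysis.
From mathcomp Require Import measurable_realfun ring lra zify.

(** Convergence in distribution gives the convergence of the moments of order
    [p] as soon as the normalized sums are bounded in weak [L^p'] for some
    [p' > p]. So the theorem reduces to the uniform bound
    [mu (|S_n f| > t a_n) <= A t ^ (- p')], where [p'] is the critical exponent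
    ([normalized_weak_type]).

    The convergence in distribution already says that the normalized sums are
    tight ([cvg_in_distribution_tight]), and tightness can be bootstrapped as in
    the Hoffmann-Jorgensen inequality for sums of independent variables. What
    replaces independence is bounded distortion. A set of points with a given
    itinerary up to a return to the base is mapped onto the whole base, and its
    relative measure is distorted by a bounded factor; hence, up to a constant,
    what happens after the return is independent of the itinerary before it
    ([quasi_independence]).

    Let [M_n] be the maximum of [|S_m f|] over [m <= n]. Stop the orbit at the
    first return to the base after a sum has exceeded [2 t]. If the orbit
    returns to the base within a time [s], a small multiple of [t], then the
    time lost by waiting for the return, and the variation of the Lipschitz
    function [f] inside the cylinder, change the sums by at most [t / 2]. The
    stopping time can therefore be chosen as a function of the itinerary, and for
    [M_n] to exceed [4 t] the sums must exceed [t] again after it. This gives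
    [mu (M_n > 4 t) <= mu (late return) + D mu (M_n > t) ^ 2]
    ([exceeds_square]); the same stopping argument gives a maximal inequality
    that bounds [M_n] by the individual sums ([exceeds_last]).

    The probability of a late return is where the tail enters. By invariance of
    the measure, the measure of the points that avoid the base for a time [s]
    is the sum of the tails beyond [s], of order [s ^ (1 - q)]
    ([pr_avoid_le]), and there are about [n / s] windows to consider, whence a
    bound of order [n t ^ (- q)] ([late_return_scale]). For [t] at most of order
    [n], beyond which [M_n] cannot go, this is at most a multiple of
    [(a_n / t) ^ p'] exactly because of the value of the critical exponent
    ([normalization_scale]). Tightness makes [D mu (M_n > t)] small once [t] is
    a large multiple of [a_n], and the quadratic recursion then propagates the
    bound from [t] to [4 t] ([weak_type_bootstrap]).

    The limiting moment does not vanish because the limit law is not a Dirac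
    mass, so the asymptotics of the moments follow on undoing the
    normalization. *)

Import Order.TTheory GRing.Theory Num.Theory.
Import numFieldNormedType.Exports.

Local Open Scope classical_set_scope.
Local Open Scope ring_scope.

Set Implicit Arguments.
Unset Strict Implicit.
Unset Printing Implicit Defensive.

(** * Finite measures with real values *)

Section RealValuedProbability.
Context {R : realType} {d : measure_display} {X : measurableType d}.
Context {mu : probability X R}.

Lemma fineM_mu (A : set X) : measurable A -> mu A = (fine (mu A))%:E.
Proof. by move=> mA; rewrite fineK// fin_num_measure. Qed.

Lemma pr_ge0 (A : set X) : 0 <= fine (mu A).
Proof. by rewrite fine_ge0. Qed.

Lemma pr_le1 (A : set X) : measurable A -> fine (mu A) <= 1.
Proof. by move=> mA; rewrite -lee_fin -fineM_mu// probability_le1. Qed.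

Lemma le_pr (A B : set X) : measurable A -> measurable B -> A `<=` B ->
  fine (mu A) <= fine (mu B).
Proof. by move=> mA mB AB; rewrite -lee_fin -!fineM_mu// le_measure ?inE. Qed.

Lemma prU_le (A B : set X) : measurable A -> measurable B ->
  fine (mu (A `|` B)) <= fine (mu A) + fine (mu B).
Proof.
move=> mA mB; rewrite -lee_fin EFinD -!fineM_mu//; first exact: measureU2.
exact: measurableU.
Qed.

Lemma pr_bigU_le n (A : nat -> set X) : (forall i, measurable (A i)) ->
  fine (mu (\big[setU/set0]_(i < n) A i)) <= \sum_(i < n) fine (mu (A i)).
Proof.
move=> mA; elim: n => [|n IHn]; first by rewrite !big_ord0 measure0.
rewrite !big_ord_recr /=; apply: le_trans (lerD IHn (lexx _)).
by apply: prU_le => //; exact: bigsetU_measurable.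
Qed.

End RealValuedProbability.

(** * Levels, itineraries and measurability *)

Section Levels.
Context {R : realType} {d : measure_display} {X : measurableType d}.
Context {mu : probability X R} {T : tower X} {rho : R}.
Hypothesis hT : young_tower mu T rho.

Lemma in_level (x : X) : exists a i, (i < height a)%N /\ level (t:=T) a i x.
Proof.
have [cov _ _] := yt_partition hT.
have : [set: X] x by [].
by rewrite -cov => -[[a i] /= hi Lx]; exists a, i.
Qed.

Lemma level_unique a i b j (x : X) : (i < height a)%N -> (j < height b)%N ->
  level (t:=T) a i x -> level (t:=T) b j x -> a = b /\ i = j.
Proof.
move=> hi hj Lx Mx; have [_ triv _] := yt_partition hT.
have : (a, i) = (b, j).
  by apply: triv => //=; exists x.
by case.
Qed.

Lemma same_level_refl (x : X) : same_level T x x.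
Proof. by have [a [i [hi Lx]]] := in_level x; exists a, i. Qed.

Lemma same_level_sym (x y : X) : same_level T x y -> same_level T y x.
Proof. by move=> [a [i [hi Lx Ly]]]; exists a, i. Qed.

Lemma same_level_trans (y x z : X) :
  same_level T x y -> same_level T y z -> same_level T x z.
Proof.
move=> [a [i [hi Lx Ly]]] [b [j [hj My Mz]]].
have [ab ij] := level_unique hi hj Ly My; subst.
by exists b, j.
Qed.

Lemma same_level_base (x y : X) : same_level T x y -> base T x -> base T y.
Proof.
move=> [a [i [hi Lx Ly]]] [b _ Bx].
have [ab ij] := level_unique hi (yt_height hT b) Lx Bx; subst.
by exists b.
Qed.

(** Encoding the levels by natural numbers makes the partition into levels a
    partition into countably many fibers of one function. *)
Definition cell (x : X) : nat :=
  xget 0%N [set k | exists a i,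
    [/\ (i < @height X T a)%N, level a i x & k = choice.pickle (a, i)]].

Lemma cellE a i (x : X) : (i < height a)%N -> level (t:=T) a i x ->
  cell x = choice.pickle (a, i).
Proof.
move=> hi Lx; rewrite /cell; apply: xget_unique; first by exists a, i.
move=> k [b [j [hj My ->]]].
by have [-> ->] := level_unique hi hj Lx My.
Qed.

Lemma same_levelE (x y : X) : same_level T x y <-> cell x = cell y.
Proof.
split=> [[a [i [hi Lx Ly]]]|].
  by rewrite (cellE hi Lx) (cellE hi Ly).
have [a [i [hi Lx]]] := in_level x; have [b [j [hj Ly]]] := in_level y.
rewrite (cellE hi Lx) (cellE hj Ly) => /(pcan_inj (@choice.pickleK _)).
by case=> ab ij; subst; exists b, j.
Qed.

Lemma measurable_tmap : measurable_fun setT T.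
Proof. by have [] := yt_preserving hT. Qed.

Lemma measurable_iter n : measurable_fun setT (iter n T).
Proof.
elim: n => [|n IHn] /=; first exact: measurable_id.
exact: (measurableT_comp measurable_tmap IHn).
Qed.

Lemma mu_preimage (A : set X) : measurable A -> mu (T @^-1` A) = mu A.
Proof. by have [_] := yt_preserving hT; apply. Qed.

Lemma mu_iter_preimage n (A : set X) : measurable A ->
  mu ((iter n T) @^-1` A) = mu A.
Proof.
move=> mA; elim: n => [|n IHn] //.
rewrite -IHn -[RHS]mu_preimage; last first.
  by rewrite -[_ @^-1` _]setTI; exact: measurable_iter.
by congr (mu _); apply/seteqP; split=> x /=; rewrite -iterSr.
Qed.

Lemma measurable_base : measurable (base T).
Proof.
rewrite /base.
have -> : \bigcup_(a in [set: tidx T]) level a 0 = \bigcup_(n : nat)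
   (if choice.unpickle n is Some a then @level X T a 0 else set0).
  apply/seteqP; split=> x.
    by case=> a _ Lx; exists (choice.pickle a) => //; rewrite choice.pickleK.
  by case=> n _; case: choice.unpickle => // a Lx; exists a.
apply: bigcupT_measurable => n; case: choice.unpickle => // a.
exact: (yt_measurable hT (yt_height hT a)).
Qed.

Lemma measurable_iter_base n : measurable [set x | base T (iter n T x)].
Proof.
have := measurable_iter n measurableT measurable_base.
by rewrite setTI.
Qed.

Lemma measurable_cell k : measurable [set x | cell x = k].
Proof.
have [[x0 x0k]|no] := pselect (exists x, cell x = k); last first.
  rewrite (_ : [set _ | _] = set0); first exact: measurable0.
  by apply/seteqP; split=> x //= xk; case: no; exists x.
have [a [i [hi Lx]]] := in_level x0.
rewrite (_ : [set _ | _] = level (t:=T) a i); first exact: (yt_measurable hT).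
apply/seteqP; split=> x /=.
  rewrite -x0k => /esym/same_levelE [b [j [hj Lx0 Ly]]].
  by have [-> ->] := level_unique hi hj Lx Lx0.
by move=> Lx'; rewrite -x0k; apply/same_levelE; exists a, i.
Qed.

Definition same_until r (x y : X) : Prop :=
  forall j, (j < r)%N -> same_level T (iter j T x) (iter j T y).

Lemma same_until_refl r (x : X) : same_until r x x.
Proof. by move=> j _; exact: same_level_refl. Qed.

Lemma same_until_sym r (x y : X) : same_until r x y -> same_until r y x.
Proof. by move=> xy j /xy/same_level_sym. Qed.

Lemma same_until_trans r (y x z : X) :
  same_until r x y -> same_until r y z -> same_until r x z.
Proof. by move=> xy yz j jr; exact: (same_level_trans (xy j jr) (yz j jr)). Qed.

Lemma same_until_le r r' (x y : X) : (r' <= r)%N ->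
  same_until r x y -> same_until r' x y.
Proof. by move=> rr xy j /leq_trans /(_ rr) /xy. Qed.

Lemma same_until_shift i r (x y : X) : (i <= r)%N ->
  same_until r x y -> same_until (r - i) (iter i T x) (iter i T y).
Proof. by move=> ir xy j jri; rewrite -!iterD; apply: xy; lia. Qed.

Lemma same_untilS r (x y : X) : same_until r.+1 x y <->
  same_level T x y /\ same_until r (T x) (T y).
Proof.
split=> [xy|[xy0 xy] [|j] jr] //.
- split; first exact: (xy 0%N).
  by move=> j jr; rewrite -!iterSr; exact: xy.
- by rewrite !iterSr; exact: xy.
Qed.

Lemma same_until_base r j (x y : X) : same_until r x y -> (j < r)%N ->
  base T (iter j T x) -> base T (iter j T y).
Proof. by move=> xy jr; apply: same_level_base; exact: xy. Qed.

Definition itinerary r (x : X) : nat :=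
  choice.pickle [seq cell (iter j T x) | j <- iota 0 r].

Lemma same_untilE r (x y : X) :
  same_until r x y <-> itinerary r x = itinerary r y.
Proof.
rewrite /itinerary; split=> [xy|/(pcan_inj (@choice.pickleK _)) eq_s j jr].
  congr choice.pickle; apply/eq_in_map => j; rewrite mem_iota /= add0n => jr.
  by apply/same_levelE; exact: xy.
apply/same_levelE.
have := congr1 (fun s => nth 0%N s j) eq_s.
by rewrite !(nth_map 0%N) ?size_iota// nth_iota.
Qed.

Lemma measurable_same_until r (x : X) : measurable [set y | same_until r x y].
Proof.
elim: r x => [|r IHr] x.
  rewrite (_ : [set _ | _] = setT) //.
  by apply/seteqP; split=> // y _ j.
rewrite (_ : [set _ | _] = [set y | cell y = cell x] `&`
   T @^-1` [set y | same_until r (T x) y]).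
  apply: measurableI; first exact: measurable_cell.
  by rewrite -[_ @^-1` _]setTI; apply: measurable_tmap.
apply/seteqP; split=> y /=.
  by move/same_untilS => [/same_levelE -> ?].
by case=> e ?; apply/same_untilS; split=> //; apply/same_levelE.
Qed.

Lemma measurable_itinerary r k : measurable [set x | itinerary r x = k].
Proof.
have [[x0 x0k]|no] := pselect (exists x, itinerary r x = k); last first.
  rewrite (_ : [set _ | _] = set0); first exact: measurable0.
  by apply/seteqP; split=> x //= xk; case: no; exists x.
rewrite (_ : [set _ | _] = [set y | same_until r x0 y]).
  exact: measurable_same_until.
apply/seteqP; split=> y /=.
  by move=> yk; apply/same_untilE; rewrite yk.
by move/same_untilE => <-.
Qed.

(** There are countably many itineraries of length [r], each followed by a
    measurable set of points, so that measurability is automatic for a set that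
    is decided by the itinerary. *)
Lemma measurable_saturated r (E : set X) :
  (forall x y, E x -> same_until r x y -> E y) -> measurable E.
Proof.
move=> satE.
rewrite (_ : E = \bigcup_k (if `[< exists2 x, E x & itinerary r x = k >]
    then [set x | itinerary r x = k] else set0)).
  apply: bigcupT_measurable => k; case: ifPn => _; last exact: measurable0.
  exact: measurable_itinerary.
apply/seteqP; split=> x.
  move=> Ex; exists (itinerary r x) => //.
  by rewrite ifT//; apply/asboolP; exists x.
move=> [k _]; case: ifPn => // /asboolP[y Ey yk] /= xk.
by apply: (satE y) => //; apply/same_untilE; rewrite yk.
Qed.

Lemma climb_base a i (x : X) : (i.+1 < height a)%N -> level (t:=T) a i x ->
  ~ base T (T x).
Proof.
move=> hi Lx [b _ Bx].
have [TL _ _] := yt_climb hT hi.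
have := level_unique hi (yt_height hT b) (TL _ Lx) Bx.
by case.
Qed.

Lemma level_iter a i j (x : X) : (i + j < height a)%N -> level (t:=T) a i x ->
  level (t:=T) a (i + j) (iter j T x).
Proof.
elim: j => [|j IHj] hij Lx; first by rewrite addn0.
rewrite addnS; have [TL _ _] : set_bij (level (t:=T) a (i + j)) (level a (i + j).+1) T.
  by apply: (yt_climb hT); rewrite -addnS.
by apply: TL; apply: IHj => //; lia.
Qed.

Lemma level_return a i (x : X) : (i < height a)%N -> level (t:=T) a i x ->
  base T (iter (height a - i) T x).
Proof.
move=> hi Lx.
have -> : (height a - i = (height a - i).-1.+1)%N by lia.
have [TL _ _] := yt_return hT a.
apply: TL.
have -> : (height a).-1 = (i + (height a - i).-1)%N by lia.
by apply: level_iter => //; lia.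
Qed.

Lemma returns (x : X) : exists2 n, (0 < n)%N & base T (iter n T x).
Proof.
have [a [i [hi Lx]]] := in_level x.
by exists (height a - i)%N; [lia|exact: level_return].
Qed.

End Levels.

(** * Separation distance and bounded distortion *)

Section Distortion.
Context {R : realType} {d : measure_display} {X : measurableType d}.
Context {mu : probability X R} {T : tower X} {rho : R}.
Hypothesis hT : young_tower mu T rho.

Lemma rho_gt0 : 0 < rho. Proof. by have /andP[] := yt_rho hT. Qed.
Lemma rho_lt1 : rho < 1. Proof. by have /andP[] := yt_rho hT. Qed.

(** The time [0] is excluded because the separation time counts the returns at
    positive times, and the time [r] because two points with the same itinerary
    at the times [j < r] may be separated at the time [r]. *)
Definition visits r (x : X) : nat :=
  count (fun j => `[< base T (iter j T x) >]) (iota 1 r.-1).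

Lemma visitsS r (x : X) : (0 < r)%N ->
  visits r.+1 x = (`[< base T (T x) >] + visits r (T x))%N.
Proof.
case: r => // r _; rewrite /visits /= (iotaDl 1 1 r) count_map.
by congr (_ + _)%N; apply: eq_count => j /=; rewrite -iterSr.
Qed.

Lemma tdist_le r (x y : X) : same_until (T:=T) r x y ->
  tdist T rho x y <= rho ^+ visits r x.
Proof.
move=> xy; have r0 := rho_gt0; have r1 := rho_lt1.
rewrite /tdist; case: ifPn => [/asboolP fJ|_]; last by rewrite exprn_ge0// ltW.
rewrite ler_wiXn2l ?(ltW r0) ?(ltW r1)//.
rewrite /visits -size_filter; apply: uniq_leq_size.
  by rewrite filter_uniq// iota_uniq.
move=> j; rewrite mem_filter mem_iota => /andP[/asboolP bj /andP[j1 jr]].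
change (is_true (j \in fset_set (joint_returns T x y)))%fset.
rewrite in_fset_set// inE; split=> // k kj; apply: xy; lia.
Qed.

Lemma tdist_ge0 (x y : X) : 0 <= tdist T rho x y.
Proof.
by rewrite /tdist; case: ifPn => // _; rewrite exprn_ge0// ltW// rho_gt0.
Qed.

Lemma pr_jacobian_le (J : X -> R) a i (A : set X) (c : R) :
  is_jacobian mu T J -> (i < height a)%N -> measurable A ->
  A `<=` level (t:=T) a i -> (forall y, A y -> J y <= c) ->
  fine (mu (T @` A)) <= c * fine (mu A).
Proof.
move=> [mJ J0 hJ] hi mA AL Jc.
have mTA := yt_bimeasurable hT hi mA AL.
rewrite -lee_fin EFinM -!fineM_mu// (hJ a i)// -integral_cst//.
have [[y Ay]|noA] := pselect (exists y, A y); last first.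
  suff -> : A = set0 by rewrite !integral_set0.
  by apply/seteqP; split=> y // Ay; case: noA; exists y.
apply: ge0_le_integral => //.
- by move=> x _; rewrite lee_fin ltW.
- by apply/measurable_EFinP; apply: measurable_funTS.
Qed.

Lemma pr_jacobian_ge (J : X -> R) a i (A : set X) (c : R) :
  is_jacobian mu T J -> (i < height a)%N -> measurable A -> 0 <= c ->
  A `<=` level (t:=T) a i -> (forall y, A y -> c <= J y) ->
  c * fine (mu A) <= fine (mu (T @` A)).
Proof.
move=> [mJ J0 hJ] hi mA c0 AL Jc.
have mTA := yt_bimeasurable hT hi mA AL.
rewrite -lee_fin EFinM -!fineM_mu// (hJ a i)// -integral_cst//.
apply: ge0_le_integral => //.
- by apply/measurable_EFinP; apply: measurable_funTS.
Qed.

(** The part of a column below its top is mapped injectively to levels that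
    nothing else enters, so that [A] is the preimage of its image and the
    invariance of the measure applies. The jacobian is thus controlled through
    the measure, not pointwise: summing its distortion over all the levels of a
    high column would not give a bounded constant. *)
Lemma pr_climb a i (A : set X) : (i.+1 < height a)%N -> measurable A ->
  A `<=` level (t:=T) a i -> fine (mu (T @` A)) = fine (mu A).
Proof.
move=> hi mA AL.
have mTA : measurable (T @` A) by apply: (yt_bimeasurable hT _ mA AL); lia.
rewrite -(mu_preimage hT mTA); congr (fine (mu _)).
apply/seteqP; split=> z; last by exists z.
move=> [y Ay TyTz].
have [b [j [hj Lz]]] := in_level hT z.
have [TL Tinj _] := yt_climb hT hi.
have LTz : level (t:=T) a i.+1 (T z) by rewrite -TyTz; apply: TL; exact: AL.
have [hj'|hj'] := ltnP j.+1 (height b).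
  have [TL' _ _] := yt_climb hT hj'.
  have [ab [ij]] := level_unique hT hj' hi (TL' _ Lz) LTz.
  subst; rewrite -(Tinj y z) ?inE//; by apply: AL.
have ej : j = (height b).-1 by lia.
have [TL' _ _] := yt_return hT b.
have [c _ Bc] : base T (T z) by apply: TL'; rewrite -ej.
by have [_] := level_unique hT (yt_height hT c) hi Bc LTz.
Qed.

(** The image of the level of [x] is the whole next level, or the whole base
    when [x] is at the top of its column. *)
Lemma same_level_lift (x z : X) :
  same_level T (T x) z \/ (base T (T x) /\ base T z) ->
  exists2 y, same_level T x y & T y = z.
Proof.
have [a [i [hi Lx]]] := in_level hT x.
have [hi'|hi'] := ltnP i.+1 (height a).
  move=> [[b [j [hj LTx Lz]]]|[bTx _]]; last by have := climb_base hT hi' Lx.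
  have [TL _ Tsurj] := yt_climb hT hi'.
  have [ab ij] := level_unique hT hj hi' LTx (TL _ Lx); subst.
  by have [y Ly Tyz] := Tsurj _ Lz; exists y => //; exists a, i.
have ei : i = (height a).-1 by lia.
have [TL _ Tsurj] := yt_return hT a; rewrite -ei in TL Tsurj.
have bTx : base T (T x) := TL _ Lx.
move=> H; have bz : base T z.
  by case: H => [H|[]//]; exact: (same_level_base hT H bTx).
by have [y Ly Tyz] := Tsurj _ bz; exists y => //; exists a, i.
Qed.

(** A return cylinder. The levels occupied at the time [r] are left free, so
    that the iterate of order [r] maps it onto the whole base. *)
Definition cylinder r (x : X) : set X :=
  [set y | same_until (T:=T) r x y /\ base T (iter r T y)].

Lemma measurable_cylinder r (x : X) : measurable (cylinder r x).
Proof.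
apply: measurableI; first exact: (measurable_same_until hT).
exact: (measurable_iter_base hT).
Qed.

Lemma measurable_iter_preimage r (B : set X) : measurable B ->
  measurable (iter r T @^-1` B).
Proof. by move=> mB; rewrite -[_ @^-1` _]setTI; exact: (measurable_iter hT). Qed.

Lemma image_cylinder r (x : X) (B : set X) : base T (iter r.+1 T x) ->
  T @` (cylinder r.+1 x `&` iter r.+1 T @^-1` B) =
  cylinder r (T x) `&` iter r T @^-1` B.
Proof.
move=> bx; apply/seteqP; split=> z.
  move=> [y [[/same_untilS[xy xy'] by_] By] <-].
  by split; [split|]; rewrite /= -?iterSr.
move=> [[xz bz] Bz].
have [y xy Tyz] : exists2 y, same_level T x y & T y = z.
  apply: same_level_lift; case: r bx xz bz Bz => [|r] bx xz bz Bz.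
    by right.
  by left; exact: (xz 0%N).
exists y => //; split; last by rewrite /= -iterS iterSr Tyz.
split; last by rewrite iterSr Tyz.
by apply/same_untilS; rewrite Tyz.
Qed.

(** The relative measure of a subset of the cylinder changes only when the orbit
    leaves the top of a column, and the logarithm of the change is then bounded
    in proportion to [rho] to the power of the number of returns that remain
    before the time [r]. These exponents are all different, except for the last
    passage, which ends at the time [r] and gives the additional [1]. *)
Definition distortion r (x : X) : R :=
  if r is 0%N then 0 else 1 + \sum_(j < visits r x) rho ^+ j.

Section JacobianBound.
Variables (J : X -> R) (C : R).
Hypotheses (hJ : is_jacobian mu T J) (C0 : 0 <= C).
Hypothesis distJ : forall x y, same_level T x y ->
  `|ln (J x)^-1 - ln (J y)^-1| <= C * tdist T rho (T x) (T y).

Lemma jacobian_ratio r (x y : X) : same_until (T:=T) r.+1 x y ->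
  J x * expR (- (C * rho ^+ visits r (T x))) <= J y <=
  J x * expR (C * rho ^+ visits r (T x)).
Proof.
move=> /same_untilS[xy xy']; have [_ J0 _] := hJ.
have := distJ xy; rewrite !lnV ?posrE// => H.
have {H} : `|ln (J y) - ln (J x)| <= C * rho ^+ visits r (T x).
  apply: le_trans (ler_wpM2l C0 (tdist_le xy')).
  by apply: le_trans H; rewrite opprK addrC.
rewrite ler_distl => /andP[l u].
have -> : J y = expR (ln (J y)) by rewrite lnK ?posrE.
rewrite -(@lnK _ (J x)) ?posrE// -!expRD !ler_expR.
by rewrite l u.
Qed.

Lemma distortion_climb r (x : X) : ~ base T (T x) -> base T (iter r.+1 T x) ->
  distortion r.+1 x = distortion r (T x).
Proof.
move=> nb; case: r => [//|r] _; rewrite /distortion visitsS//.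
by rewrite (_ : `[< _ >] = false)//; apply/asboolP.
Qed.

Lemma distortion_return r (x : X) : base T (T x) ->
  distortion r.+1 x = distortion r (T x) + rho ^+ visits r (T x).
Proof.
move=> b; rewrite /distortion; case: r => [|r].
  by rewrite /visits/= big_ord0 addr0 add0r expr0.
by rewrite visitsS// asboolT// add1n big_ord_recr /= addrA.
Qed.

(** Induction on [r]: one step of the dynamics preserves the proportion of the
    cylinder that is sent into [B] below the top of a column, and at the top
    changes it by the oscillation of the jacobian, which occurs twice because
    both the cylinder and the subset are compared with the value at [x]. *)
Lemma cylinder_distortion r (x : X) (B : set X) : base T (iter r T x) ->
  measurable B -> B `<=` base T ->
  fine (mu (cylinder r x `&` iter r T @^-1` B)) * fine (mu (base T)) <=
  expR (2 * C * distortion r x) * fine (mu (cylinder r x)) * fine (mu B).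
Proof.
move=> + mB BT; elim: r x => [|r IHr] x bx.
  rewrite /distortion mulr0 expR0 mul1r mulrC.
  have -> : cylinder 0 x = base T by apply/seteqP; split=> // y [].
  by have /setIidPr -> : iter 0 T @^-1` B `<=` base T.
have {}IHr := IHr (T x); rewrite -iterSr in IHr.
have {}IHr := IHr bx.
set E := cylinder r.+1 x `&` _; set A := cylinder r.+1 x.
have mA : measurable A by exact: measurable_cylinder.
have mE : measurable E by apply: measurableI => //; exact: measurable_iter_preimage.
have TE : T @` E = cylinder r (T x) `&` iter r T @^-1` B by exact: image_cylinder.
have TA : T @` A = cylinder r (T x).
  have := image_cylinder setT bx.
  by rewrite !preimage_setT !setIT.
rewrite -TE -TA in IHr.
have [a [i [hi Lx]]] := in_level hT x.
have AL : A `<=` level (t:=T) a i.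
  move=> y [/same_untilS[[b [j [hj Mx My]]] _] _].
  by have [<- <-] := level_unique hT hj hi Mx Lx.
have EL : E `<=` level (t:=T) a i by move=> y [/AL].
have [hi'|hi'] := ltnP i.+1 (height a).
  rewrite !(pr_climb hi')// in IHr.
  by rewrite distortion_climb//; exact: (climb_base hT hi').
set V := visits r (T x) in IHr *.
have bTx : base T (T x).
  have [TL _ _] := yt_return hT a; apply: TL.
  by have -> : (height a).-1 = i by lia.
rewrite distortion_return// -/V.
set e := C * rho ^+ V.
have [_ J0 _] := hJ.
have Eu : J x * expR (- e) * fine (mu E) <= fine (mu (T @` E)).
  apply: (pr_jacobian_ge hJ hi) => //.
    by rewrite mulr_ge0 ?expR_ge0// ltW.
  by move=> y [[xy _] _]; have /andP[] := jacobian_ratio xy.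
have Al : fine (mu (T @` A)) <= J x * expR e * fine (mu A).
  apply: (pr_jacobian_le hJ hi) => //.
  by move=> y [xy _]; have /andP[] := jacobian_ratio xy.
have cx : 0 < J x * expR (- e) by rewrite mulr_gt0 ?expR_gt0.
rewrite -(ler_pM2l cx).
rewrite mulrA; apply: le_trans (ler_wpM2r (pr_ge0 _) Eu) _.
apply: le_trans IHr _.
rewrite mulrDr expRD.
apply: le_trans (ler_wpM2r (pr_ge0 _) (ler_wpM2l (expR_ge0 _) Al)) _.
have -> : 2 * C * rho ^+ V = e + e by rewrite /e; lra.
have {1}-> : expR e = expR (- e) * expR (e + e).
  by rewrite -expRD; congr expR; lra.
rewrite le_eqVlt; apply/orP; left; apply/eqP; ring.
Qed.

Lemma distortion_le r (x : X) : distortion r x <= 1 + (1 - rho)^-1.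
Proof.
have r1 := rho_lt1; have r0 := rho_gt0.
have H : 0 < 1 - rho by rewrite subr_gt0.
have geo n : (1 - rho) * (\sum_(j < n) rho ^+ j) = 1 - rho ^+ n.
  elim: n => [|n IHn]; first by rewrite big_ord0 mulr0 expr0 subrr.
  by rewrite big_ord_recr /= mulrDr IHn exprSr; lra.
have H' : 0 < (1 - rho)^-1 by rewrite invr_gt0.
rewrite /distortion; case: r => [|r]; first by lra.
rewrite lerD2l -(ler_pM2l H) geo divff ?gt_eqF//.
by rewrite gerBl exprn_ge0// ltW.
Qed.

End JacobianBound.

End Distortion.

(** * Quasi-independence after a return to the base *)

Section QuasiIndependence.
Context {R : realType} {d : measure_display} {X : measurableType d}.
Context {mu : probability X R} {T : tower X} {rho : R}.
Hypothesis hT : young_tower mu T rho.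

(** All points return to the base, so that countably many preimages of the base
    cover the space. *)
Lemma pr_base_gt0 : 0 < fine (mu (base T)).
Proof.
have mB := measurable_base hT.
rewrite lt_neqAle pr_ge0 andbT eq_sym; apply/eqP => B0.
have {}B0 : mu (base T) = 0%E by rewrite fineM_mu// B0.
have : mu.-negligible (\bigcup_n (iter n T @^-1` base T)).
  apply: negligible_bigcup => n; apply/negligibleP.
    exact: (measurable_iter_preimage hT).
  exact: (etrans (mu_iter_preimage hT n mB)).
have -> : \bigcup_n (iter n T @^-1` base T) = setT.
  by apply/seteqP; split=> // x _; have [n _ bn] := returns hT x; exists n.
move/negligibleP => /(_ measurableT) m0.
by have := probability_setT mu; rewrite m0 => /eqP; rewrite eq_sym onee_eq0.
Qed.

(** The unions of return cylinders of length [r]. *)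
Definition return_set r (E : set X) : Prop :=
  (forall x, E x -> base T (iter r T x)) /\
  forall x y, E x -> same_until (T:=T) r x y -> base T (iter r T y) -> E y.

Lemma measurable_return_set r (E : set X) : return_set r E -> measurable E.
Proof.
move=> [bE sE].
rewrite (_ : E = [set x | base T (iter r T x)] `&`
    [set x | exists2 y, E y & same_until (T:=T) r y x]).
  apply: measurableI; first exact: (measurable_iter_base hT).
  apply: (measurable_saturated hT (r := r)) => x y [z Ez zx] xy; exists z => //.
  exact: (same_until_trans hT zx xy).
apply/seteqP; split=> x.
  by move=> Ex; split; [exact: bE|exists x => //; exact: (same_until_refl hT)].
by move=> [bx [y Ey yx]]; exact: (sE y).
Qed.

(** A return cylinder is mapped onto the base with bounded distortion, so that
    what happens after a return is independent of the past up to a constant.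
    The inequality is summed over the countably many cylinders in [E]. *)
Lemma quasi_independence : exists2 D : R, 0 < D &
  forall r E B, return_set r E -> measurable B -> B `<=` base T ->
    fine (mu (E `&` iter r T @^-1` B)) <= D * fine (mu E) * fine (mu B).
Proof.
have b0 := pr_base_gt0.
have [J hJ [C1 HC1]] := yt_distortion hT.
pose C := `|C1|.
have C0 : 0 <= C by exact: normr_ge0.
have distJ x y : same_level T x y ->
    `|ln (J x)^-1 - ln (J y)^-1| <= C * tdist T rho (T x) (T y).
  move=> /HC1 /le_trans; apply; apply: ler_wpM2r; last exact: ler_norm.
  exact: (tdist_ge0 hT).
pose D := expR (2 * C * (1 + (1 - rho)^-1)) / fine (mu (base T)).
have D0 : 0 < D by rewrite divr_gt0 ?expR_gt0.
exists D => // r E B rE mB BT; have mE := measurable_return_set rE.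
have [bE sE] := rE.
have mrB : measurable (iter r T @^-1` B) by exact: (measurable_iter_preimage hT).
pose F k := E `&` [set x | itinerary (T:=T) r x = k].
have mF k : measurable (F k).
  by apply: measurableI => //; exact: (measurable_itinerary hT).
have EF : E = \bigcup_k F k.
  apply/seteqP; split=> x; last by move=> [k _ []].
  by move=> Ex; exists (itinerary (T:=T) r x).
have triF (G : set X) : trivIset setT (fun k => F k `&` G).
  by move=> i j _ _ [x [[[_ /= xi] _] [[_ /= xj] _]]]; rewrite -xi.
have leF k : (mu (F k `&` iter r T @^-1` B) <= (D * fine (mu B))%:E * mu (F k))%E.
  have [[x [Ex /= xk]]|no] := pselect (exists x, F k x); last first.
    have -> : F k = set0 by apply/seteqP; split=> x // Fx; case: no; exists x.
    by rewrite set0I !measure0 mule0.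
  have FE : F k = cylinder (T:=T) r x.
    apply/seteqP; split=> y; last first.
      move=> [xy bry]; split; first exact: (sE x).
      by rewrite /= -xk; apply/esym/(same_untilE hT).
    move=> [Ey /= yk]; split; last exact: bE.
    by apply/(same_untilE hT); rewrite xk.
  have mFk := mF k; have mI : measurable (F k `&` iter r T @^-1` B) by exact: measurableI.
  rewrite (fineM_mu mI) (fineM_mu mFk) -EFinM lee_fin.
  rewrite -(ler_pM2r b0) FE.
  apply: le_trans (cylinder_distortion hT hJ C0 distJ (bE _ Ex) mB BT) _.
  have -> : D * fine (mu B) * fine (mu (cylinder (T:=T) r x)) * fine (mu (base T)) =
      expR (2 * C * (1 + (1 - rho)^-1)) * fine (mu (cylinder (T:=T) r x)) * fine (mu B).
    by rewrite /D; field; rewrite gt_eqF.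
  rewrite ler_wpM2r ?pr_ge0// ler_wpM2r ?pr_ge0// ler_expR.
  by rewrite ler_wpM2l ?(distortion_le hT)// mulr_ge0.
have mI : measurable (E `&` iter r T @^-1` B) by exact: measurableI.
rewrite -lee_fin mulrAC EFinM -!fineM_mu//.
rewrite {1}EF setI_bigcupl.
rewrite measure_bigcup//; last by move=> k _; exact: measurableI.
apply: le_trans (lee_nneseries _ _) _.
- by [].
- by move=> k _; exact: leF.
rewrite nneseriesZl//.
rewrite [in leRHS]EF measure_bigcup//.
by have := triF setT; under eq_fun do rewrite setIT.
Qed.

End QuasiIndependence.

(** * Measure of the points that avoid the base *)

Section Avoidance.
Context {R : realType} {d : measure_display} {X : measurableType d}.
Context {mu : probability X R} {T : tower X} {rho : R}.
Hypothesis hT : young_tower mu T rho.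

Definition avoid s : set X := [set x | forall j, (j < s)%N -> ~ base T (iter j T x)].

Lemma avoid_le s s' : (s <= s')%N -> avoid s' `<=` avoid s.
Proof. by move=> ss' x Ax j js; apply: Ax; exact: leq_trans ss'. Qed.

Lemma measurable_avoid s : measurable (avoid s).
Proof.
elim: s => [|s IHs].
  by rewrite (_ : avoid 0 = setT)//; apply/seteqP; split=> // x _ j.
rewrite (_ : avoid s.+1 = avoid s `\` [set x | base T (iter s T x)]).
  by apply: measurableD => //; exact: (measurable_iter_base hT).
apply/seteqP; split=> x.
  by move=> Ax; split; [exact: avoid_le Ax|exact: (Ax s)].
move=> [Ax bx] j; rewrite ltnS leq_eqVlt => /orP[/eqP -> //|]; exact: Ax.
Qed.

Definition tall n : set X :=
  [set x | exists2 a : tidx T, level a 0 x & (n <= height a)%N].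

Lemma measurable_tall n : measurable (tall n).
Proof.
rewrite (_ : tall n = \bigcup_(k : nat)
   (if choice.unpickle k is Some a then
      if (n <= @height X T a)%N then level a 0 else set0 else set0)).
  apply: bigcupT_measurable => k; case: choice.unpickle => // a.
  by case: ifP => // _; exact: (yt_measurable hT (yt_height hT a)).
apply/seteqP; split=> x.
  by case=> a La na; exists (choice.pickle a) => //; rewrite choice.pickleK na.
by case=> k _; case: choice.unpickle => // a; case: ifP => // na La; exists a.
Qed.

(** An orbit that avoids the base at the times [1, ..., s] either avoids it from
    the time [0] on or starts at the bottom of a column of height at least
    [s + 1]. By invariance, the measure of the set of these orbits is that of
    [avoid s]. *)
Lemma pr_avoidS s :
  fine (mu (avoid s)) <= fine (mu (avoid s.+1)) + tail mu T s.+1.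
Proof.
have mA := measurable_avoid; have mT := measurable_tall s.+1.
rewrite -(mu_preimage hT (mA s)); apply: le_trans (prU_le (mA _) mT).
apply: le_pr => //.
- by rewrite -[_ @^-1` _]setTI; exact: (measurable_tmap hT).
- exact: measurableU.
move=> x Ax.
have [[a _ Lx]|nb] := pselect (base T x); last first.
  by left=> -[|j] js //; rewrite iterSr; exact: Ax.
right; exists a => //; rewrite ltnNge; apply/negP => hs.
have h0 := yt_height hT a.
have := level_return hT h0 Lx; rewrite subn0.
have -> : height a = (height a).-1.+1 by lia.
by rewrite iterSr; apply: Ax; lia.
Qed.

Lemma pr_avoid_cvg0 : fine (mu (avoid n)) @[n --> \oo] --> (0 : R).
Proof.
have I0 : \bigcap_n avoid n = set0.
  apply/seteqP; split=> // x Ax; have [n _ bn] := returns hT x.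
  exact: (Ax n.+1 Logic.I n (ltnSn n) bn).
have : mu \o avoid @ \oo --> mu (\bigcap_n avoid n).
  apply: nonincreasing_cvg_mu => //.
  - by rewrite (le_lt_trans (probability_le1 mu (measurable_avoid _)))// ltry.
  - exact: measurable_avoid.
  - by rewrite I0.
  - by move=> m n mn; apply/subsetPset; exact: avoid_le.
by rewrite I0 measure0 => /fine_cvgP[].
Qed.

(** A discrete form of the derivative of the power [1 - q], which lets the tails
    telescope. *)
Lemma powR_decrement (q : R) s : 1 < q -> (0 < s)%N ->
  (q - 1) * s.+1%:R `^ (- q) <= s%:R `^ (1 - q) - s.+1%:R `^ (1 - q).
Proof.
move=> q1 s0.
have a0 : 0 < s%:R :> R by rewrite ltr0n.
set b := s.+1%:R; set a := s%:R.
have b0 : 0 < b by rewrite ltr0n.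
have ba : b = a + 1 by rewrite /b -natr1.
have -> : b `^ (- q) = b `^ (1 - q) * b^-1.
  rewrite -(powR_inv1 (ltW b0)) -powRD; last by rewrite (gt_eqF b0) implybT.
  by congr (_ `^ _); lra.
have -> : a `^ (1 - q) = b `^ (1 - q) * expR ((q - 1) * (ln b - ln a)).
  rewrite /powR !gt_eqF// -expRD; congr expR; lra.
have lnab : b^-1 <= ln b - ln a.
  rewrite -ln_div ?posrE// -(@invrK _ (b / a)) lnV ?posrE ?invr_gt0 ?divr_gt0//.
  rewrite invf_div lerNr.
  have -> : a / b = 1 + - b^-1 by rewrite ba; field; lra.
  apply: le_ln1Dx; rewrite ltrN2 invf_lt1// ba; lra.
have E := expR_ge1Dx ((q - 1) * (ln b - ln a)).
have p0 : 0 < b `^ (1 - q) by exact: powR_gt0.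
set P := b `^ (1 - q) in p0 *; set F := expR _ in E *.
have -> : P * F - P = P * (F - 1) by ring.
rewrite mulrCA ler_pM2l//.
apply: le_trans (_ : (q - 1) * (ln b - ln a) <= _); last by lra.
by rewrite ler_pM2l// subr_gt0.
Qed.

Variables (q C : R).
Hypotheses (hq : 1 < q) (hC : 0 < C).
Hypothesis htail : asymp_equiv (tail mu T) (fun n => C * n%:R `^ (- q)).

Lemma tail_le : exists2 N, (0 < N)%N &
  forall n, (N <= n)%N -> tail mu T n <= 2 * C * n%:R `^ (- q).
Proof.
have /cvgrPdist_lt /(_ 1 ltr01)[N _ HN] := htail.
exists N.+1 => // n Nn.
have := HN n (ltnW Nn).
have p0 : 0 < C * n%:R `^ (- q) :> R.
  by rewrite mulr_gt0// powR_gt0// ltr0n; lia.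
rewrite distrC ltr_distl => /andP[_]; rewrite ltr_pdivrMr// => /ltW; lra.
Qed.

(** Iterating [pr_avoidS], the measure of the points that avoid the base for a
    time [s] is at most the sum of the tails beyond [s]: what remains after [k]
    steps tends to zero since every orbit returns to the base. *)
Lemma pr_avoid_le : exists2 K : R, 0 < K &
  forall s, (0 < s)%N -> fine (mu (avoid s)) <= K * s%:R `^ (1 - q).
Proof.
have [N N0 HN] := tail_le.
pose K := 2 * C / (q - 1).
have K0 : 0 < K by rewrite divr_gt0 ?subr_gt0// mulr_gt0.
have step s k : (N <= s)%N -> fine (mu (avoid s)) <=
    fine (mu (avoid (s + k))) + K * (s%:R `^ (1 - q) - (s + k)%:R `^ (1 - q)).
  move=> Ns; elim: k => [|k IHk]; first by rewrite addn0 subrr mulr0 addr0.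
  apply: le_trans IHk _; rewrite addnS.
  have h1 := pr_avoidS (s + k).
  have h2 : tail mu T (s + k).+1 <= 2 * C * (s + k).+1%:R `^ (- q).
    by apply: HN; lia.
  have sk0 : (0 < s + k)%N by lia.
  have h3 := powR_decrement hq sk0.
  have h4 : 2 * C * (s + k).+1%:R `^ (- q) <=
      K * ((s + k)%:R `^ (1 - q) - (s + k).+1%:R `^ (1 - q)).
    apply: le_trans (ler_wpM2l (ltW K0) h3).
    by rewrite mulrA /K divfK// gt_eqF// subr_gt0.
  lra.
have large s : (N <= s)%N -> fine (mu (avoid s)) <= K * s%:R `^ (1 - q).
  move=> Ns; apply/ler_addgt0Pl => e e0.
  have /cvgrPdist_lt /(_ e e0)[M _ HM] := pr_avoid_cvg0.
  have := HM (s + M)%N (leq_addl _ _).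
  rewrite sub0r normrN ger0_norm ?pr_ge0// => h.
  have := step s M Ns.
  have : 0 <= K * (s + M)%:R `^ (1 - q) by rewrite mulr_ge0 ?powR_ge0// ltW.
  lra.
pose K' := N%:R `^ (q - 1) : R.
have K'0 : 0 < K' by rewrite powR_gt0// ltr0n.
exists (K + K') => [|s s0]; first by rewrite addr_gt0.
have p0 : 0 < s%:R `^ (1 - q) :> R by rewrite powR_gt0// ltr0n.
have [/large|sN] := leqP N s.
  by move/le_trans; apply; rewrite ler_pM2r// lerDl ltW.
apply: le_trans (pr_le1 (measurable_avoid _)) _.
rewrite mulrDl; apply: (@le_trans _ _ (K' * s%:R `^ (1 - q))); last first.
  by rewrite lerDr mulr_ge0 ?ltW.
have -> : 1 - q = - (q - 1) by lra.
rewrite powRN ler_pdivlMr ?powR_gt0 ?ltr0n// mul1r.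
by rewrite ge0_ler_powR ?nnegrE ?ler0n ?subr_ge0 ?ltW// ltr_nat.
Qed.

End Avoidance.

(** * Lipschitz functions and their Birkhoff sums *)

Section Lipschitz.
Context {R : realType} {d : measure_display} {X : measurableType d}.
Context {mu : probability X R} {T : tower X} {rho : R}.
Hypothesis hT : young_tower mu T rho.

(** The separation of distinct points makes the number of joint returns finite,
    which excludes the value zero of the distance. *)
Lemma tdist_gt0 (x y : X) : x <> y -> 0 < tdist T rho x y.
Proof.
move=> xy; have [n nxy] := yt_separation hT xy.
rewrite /tdist ifT ?exprn_gt0 ?(rho_gt0 hT)//; apply/asboolP.
apply: (@sub_finite_set _ _ `I_n); last exact: finite_II.
move=> k [_ _ sk] /=; rewrite ltnNge; apply/negP => nk.
exact: nxy (sk _ nk).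
Qed.

Lemma lipschitz_bound (f : X -> R) : lipschitz_fun T rho f ->
  exists2 L : R, 0 < L & (forall x, `|f x| <= L) /\
    forall x y, same_level T x y -> `|f x - f y| <= L * tdist T rho x y.
Proof.
rewrite /lipschitz_fun /lip_norm.
set a := ereal_sup _; set S := (0%E |` _); set b := ereal_sup _ => ab.
have [[x0 _]|noX] := pselect (exists x : X, True); last first.
  by exists 1 => //; split=> x; case: noX; exists x.
have la x : (`|f x|%:E <= a)%E by apply: ereal_sup_ubound; exists x.
have lb z : S z -> (z <= b)%E by move=> Sz; exact: ereal_sup_ubound.
have a0 : (0 <= a)%E by apply: le_trans (la x0); rewrite lee_fin.
have b0 : (0 <= b)%E by apply: lb; left.
have afin : a \is a fin_num.
  by rewrite ge0_fin_numE// (le_lt_trans _ ab)// leeDl.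
have bfin : b \is a fin_num.
  by rewrite ge0_fin_numE// (le_lt_trans _ ab)// leeDr.
have fa0 : 0 <= fine a by rewrite fine_ge0.
have fb0 : 0 <= fine b by rewrite fine_ge0.
exists (fine a + fine b + 1); first by lra.
split=> [x|x y xy].
  have := la x; rewrite -(fineK afin) lee_fin; lra.
have [->|/eqP nxy] := eqVneq x y.
  by rewrite subrr normr0 mulr_ge0 ?(tdist_ge0 hT)//; lra.
have d0 := tdist_gt0 nxy.
rewrite -ler_pdivrMr//.
have : ((`|f x - f y| / tdist T rho x y)%:E <= b)%E.
  by apply: lb; right; exists (x, y).
by rewrite -(fineK bfin) lee_fin; lra.
Qed.

Definition frequent s r (x : X) : Prop := forall m, (m + s <= r)%N ->
  exists j, [/\ (m <= j)%N, (j < m + s)%N & base T (iter j T x)].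

Lemma frequent_same s r (x y : X) : same_until (T:=T) r x y ->
  frequent s r x -> frequent s r y.
Proof.
move=> xy Fx m mr; have [j [mj js bj]] := Fx m mr; exists j; split=> //.
by apply: (same_until_base hT xy) bj; lia.
Qed.

Lemma frequent_le s r r' (x : X) : (r' <= r)%N -> frequent s r x -> frequent s r' x.
Proof. by move=> rr Fx m mr; apply: Fx; exact: leq_trans rr. Qed.

Lemma frequent_shift s r i (x : X) : (i <= r)%N ->
  frequent s r x -> frequent s (r - i) (iter i T x).
Proof.
move=> ir Fx m mr; have [|j [mj js bj]] := Fx (m + i)%N; first by lia.
exists (j - i)%N; split; [lia|lia|].
by rewrite -iterD subnK//; lia.
Qed.

(** The windows of length [s] that start at [a], [a + s], ... are disjoint. *)
Lemma count_windows (P : pred nat) s k a :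
  (forall m, (a <= m)%N -> (m + s <= a + k * s)%N ->
    exists j, [/\ (m <= j)%N, (j < m + s)%N & P j]) ->
  (k <= count P (iota a (k * s)))%N.
Proof.
elim: k a => // k IHk a H.
rewrite mulSn iotaD count_cat.
have h1 : (0 < count P (iota a s))%N.
  have [||j [aj js Pj]] := H a; [by []|by rewrite mulSn; lia|].
  rewrite -has_count; apply/hasP; exists j => //.
  by rewrite mem_iota aj.
have h2 := IHk (a + s)%N _.
suff : (k <= count P (iota (a + s) (k * s)))%N by lia.
by apply: h2 => m am ms; apply: H => //; rewrite ?mulSn; lia.
Qed.

Lemma visits_ge s r (x : X) : (0 < s)%N -> frequent s r x ->
  (r.-1 %/ s <= visits (T:=T) r x)%N.
Proof.
move=> s0 Fx; rewrite /visits.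
have e : (r.-1 = (r.-1 %/ s) * s + r.-1 %% s)%N by exact: divn_eq.
rewrite {2}e iotaD count_cat.
apply: leq_trans (leq_addr _ _).
apply: count_windows => m m1 mk.
have [|j [mj js bj]] := Fx m; first by lia.
by exists j; split=> //; apply/asboolP.
Qed.

Lemma geometric_blocks s n : (0 < s)%N ->
  \sum_(i < n) rho ^+ (i %/ s) <= s%:R / (1 - rho).
Proof.
move=> s0; have r0 := rho_gt0 hT; have r1 := rho_lt1 hT.
have D0 : 0 < 1 - rho by rewrite subr_gt0.
rewrite ler_pdivlMr//.
have sle m : (m <= s)%N -> \sum_(i < m) rho ^+ (i %/ s) = m%:R.
  move=> ms; rewrite (eq_bigr (fun=> 1)) ?sumr_const ?card_ord// => i _.
  by rewrite divn_small ?expr0// (leq_trans (ltn_ord i)).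
elim/ltn_ind: n => n IHn.
have [ns|sn] := leqP n s.
  rewrite sle//; apply: (@le_trans _ _ n%:R); last by rewrite ler_nat.
  by rewrite ler_piMr ?ler0n// gerBl ltW.
have -> : n = (s + (n - s))%N by lia.
rewrite big_split_ord /= sle//.
under eq_bigr => i _ do rewrite divnDl// divnn s0 exprS.
rewrite -mulr_sumr.
have := IHn (n - s)%N ltac:(lia).
set S := \sum_(i < n - s) _ => IH.
have := ler_wpM2l (ltW r0) IH.
have : 0 <= S by apply: sumr_ge0 => i _; rewrite exprn_ge0// ltW.
lra.
Qed.

Variables (f : X -> R) (L : R).
Hypotheses (L0 : 0 < L) (fL : forall x, `|f x| <= L).
Hypothesis fLip : forall x y, same_level T x y -> `|f x - f y| <= L * tdist T rho x y.

Local Notation S := (birkhoff_sum T f).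

Lemma birkhoffD m n x : S (m + n) x = S m x + S n (iter m T x).
Proof.
rewrite /birkhoff_sum big_split_ord /=; congr (_ + _).
by apply: eq_bigr => i _; rewrite addnC iterD.
Qed.

Lemma birkhoff_le n x : `|S n x| <= L * n%:R.
Proof.
apply: le_trans (ler_norm_sum _ _ _) _.
apply: le_trans (ler_sum _ (fun i _ => fL _)) _.
by rewrite sumr_const card_ord mulr_natr.
Qed.

(** The distances between the iterates of the two points decay geometrically
    when one goes back in time from [r], by a factor [rho] for each block of [s]
    times: the total is that of one geometric series for each residue
    modulo [s]. *)
Lemma birkhoff_same s r m (x y : X) : (0 < s)%N -> (m <= r)%N ->
  same_until (T:=T) r x y -> frequent s r x ->
  `|S m x - S m y| <= L * s%:R / (1 - rho).
Proof.
move=> s0 mr xy Fx; have r0 := rho_gt0 hT; have r1 := rho_lt1 hT.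
rewrite /birkhoff_sum -sumrB.
apply: le_trans (ler_norm_sum _ _ _) _.
apply: (@le_trans _ _ (\sum_(i < m) L * rho ^+ ((r - i).-1 %/ s))).
  apply: ler_sum => i _; have im := ltn_ord i.
  apply: le_trans (fLip _) _; first by apply: xy; lia.
  rewrite ler_pM2l//.
  have ir : (i <= r)%N by lia.
  apply: le_trans (tdist_le hT (same_until_shift ir xy)) _.
  rewrite ler_wiXn2l ?(ltW r0) ?(ltW r1)//.
  by apply: visits_ge => //; exact: frequent_shift.
rewrite -mulr_sumr -mulrA ler_pM2l//.
apply: le_trans (geometric_blocks r s0).
rewrite [leRHS](reindex_inj rev_ord_inj) /=.
rewrite -(big_mkord xpredT (fun i => rho ^+ ((r - i).-1 %/ s))).
rewrite -(big_mkord xpredT (fun i => rho ^+ ((r - i.+1) %/ s))).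
rewrite [leRHS](@big_cat_nat _ _ _ m)//=.
rewrite [X in X <= _](eq_bigr (fun i => rho ^+ ((r - i.+1) %/ s))); last first.
  by move=> i _; rewrite subnS.
by rewrite lerDl sumr_ge0// => i _; rewrite exprn_ge0// ltW.
Qed.

Lemma visits_unbounded (x : X) N : exists k, (N <= visits (T:=T) k x)%N.
Proof.
elim: N => [|N [k Nk]]; first by exists 0%N.
have [n n0 bn] := returns hT (iter k T x).
exists (k + n).+1; rewrite /visits /=.
have -> : (k + n = k.-1 + (k + n - k.-1))%N by lia.
rewrite iotaD count_cat.
suff : (0 < count (fun j => `[< base T (iter j T x) >])
   (iota (1 + k.-1) (k + n - k.-1)))%N by rewrite /visits in Nk; lia.
rewrite -has_count; apply/hasP; exists (n + k)%N; last first.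
  by apply/asboolP; rewrite iterD.
by rewrite mem_iota; lia.
Qed.

(** The oscillation of [f] on the points with the same itinerary of length [k]
    tends to zero as [k] grows, at every point, because orbits return to the
    base infinitely often. So a strict inequality [c < f x] is decided by a
    finite itinerary. *)
Lemma measurable_lipschitz : measurable_fun setT f.
Proof.
have r0 := rho_gt0 hT; have r1 := rho_lt1 hT.
move=> mD; apply: (measurability _ (RGenOInfty.measurableE R)) => //.
move=> _ [_ [c ->] <-]; rewrite setTI.
rewrite (_ : _ @^-1` _ = \bigcup_k
    [set x | forall y, same_until (T:=T) k x y -> c < f y]).
  apply: bigcupT_measurable => k; apply: (measurable_saturated hT (r := k)).
  by move=> x y Fx xy z yz; apply: Fx; exact: (same_until_trans hT xy yz).
apply/seteqP; split=> x /=; rewrite in_itv /= ?andbT; last first.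
  by move=> [k _ Fx]; apply: Fx; exact: (same_until_refl hT).
move=> cf.
have e0 : 0 < (f x - c) / L by rewrite divr_gt0// subr_gt0.
have : `|rho| < 1 by rewrite ger0_norm// ltW.
move=> /cvg_expr /cvgrPdist_lt /(_ _ e0)[N _ /(_ N (leqnn N))].
rewrite /= sub0r normrN ger0_norm ?exprn_ge0 ?ltW// ltr_pdivlMr// => HN.
have [k Nk] := visits_unbounded x N.
exists k.+1 => // y xy.
have h1 : same_level T x y by exact: (xy 0%N).
have h2 := fLip h1.
have h3 : tdist T rho x y <= rho ^+ N.
  apply: le_trans (tdist_le hT (same_until_le (leqnSn k) xy)) _.
  by rewrite ler_wiXn2l// ltW.
have h4 := ler_wpM2l (ltW L0) h3.
by have := ler_norm (f x - f y); lra.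
Qed.

Lemma measurable_birkhoff n : measurable_fun setT (S n).
Proof.
rewrite /birkhoff_sum; apply: measurable_sum => i.
exact: (measurableT_comp measurable_lipschitz (measurable_iter hT i)).
Qed.

End Lipschitz.

(** * Maximal inequalities *)

Section MaximalInequalities.
Context {R : realType} {d : measure_display} {X : measurableType d}.
Context {mu : probability X R} {T : tower X} {rho : R}.
Hypothesis hT : young_tower mu T rho.
Variables (f : X -> R) (L : R).
Hypotheses (L0 : 0 < L) (fL : forall x, `|f x| <= L).
Hypothesis fLip : forall x y, same_level T x y -> `|f x - f y| <= L * tdist T rho x y.

Local Notation S := (birkhoff_sum T f).

Definition above m (t : R) : set X := [set x | t < `|birkhoff_sum T f m x|].

Definition exceeds n (t : R) : set X :=
  [set x | exists2 m, (m <= n)%N & above m t x].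

Lemma measurable_above m t : measurable (above m t).
Proof.
have mS : measurable_fun setT (fun x => `|S m x|).
  by apply: measurableT_comp; [exact: normr_measurable|exact: (measurable_birkhoff hT L0 fLip)].
have := mS measurableT `]t, +oo[%classic (measurable_itv _).
rewrite setTI; congr (measurable _); apply/seteqP; split=> x;
by rewrite /above /= in_itv /= andbT.
Qed.

Lemma measurable_exceeds n t : measurable (exceeds n t).
Proof.
rewrite (_ : exceeds n t = \bigcup_(m in `I_n.+1) above m t).
  by apply: bigcup_measurable => m _; exact: measurable_above.
by apply/seteqP; split=> x [m mn Ax]; exists m.
Qed.

Lemma measurable_frequent s r : measurable [set x | frequent (T:=T) s r x].
Proof.
apply: (measurable_saturated hT (r := r)) => x y Fx xy.
exact: (frequent_same hT xy Fx).
Qed.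

Section Stopping.
Variables (n s : nat) (t : R).
Hypotheses (s0 : (0 < s)%N) (t0 : 0 < t).
Hypothesis st : L * s%:R + L * s%:R / (1 - rho) <= t / 2.

(** At the return time [r] one knows that the sums may have exceeded [2 t] in
    the last [s] steps. The alarm is raised by any point [x] of the cylinder of
    [y], rather than by [y] itself, so that it depends on the itinerary only;
    the sums of [x] and [y] differ by less than the margin [t / 2]. *)
Definition alarm r : set X := [set y | [/\ base T (iter r T y), frequent (T:=T) s r y &
  exists x m, [/\ same_until (T:=T) r y x, (m <= n)%N, (m <= r <= m + s)%N &
    2 * t < `|S m x|]]].

Lemma alarm_same r (y z : X) : same_until (T:=T) r y z ->
  base T (iter r T z) -> alarm r y -> alarm r z.
Proof.
move=> yz bz [_ Fy [x [m [yx mn rm Sx]]]]; split=> //.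
  exact: (frequent_same hT yz).
exists x, m; split=> //.
exact: (same_until_trans hT (same_until_sym yz) yx).
Qed.

(** [seqDU alarm r] is the event that the first alarm rings at the time [r]:
    like a stopping time, it is decided by the itinerary up to [r]. *)
Lemma return_set_first_alarm r : return_set (T:=T) r (seqDU alarm r).
Proof.
split=> [x [[]]//|x y [Ax nAx] xy by_]; split; first exact: alarm_same Ax.
rewrite -bigcup_mkord => -[k /= kr Ay]; apply: nAx; rewrite -bigcup_mkord.
exists k => //; have [bky _ _] := Ay.
have yx := same_until_sym xy.
apply: (alarm_same (same_until_le (ltnW kr) yx) _ Ay).
exact: (same_until_base hT yx kr).
Qed.

Let gap0 : 0 <= L * s%:R. Proof. by rewrite mulr_ge0 ?ler0n// ltW. Qed.
Let gap1 : 0 <= L * s%:R / (1 - rho).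
Proof. by rewrite divr_ge0// subr_ge0 ltW// (rho_lt1 hT). Qed.

Lemma alarm_above r y : alarm r y ->
  exists m, [/\ (m <= n)%N, (m <= r <= m + s)%N & 3 / 2 * t + L * s%:R < `|S m y|].
Proof.
have st' := st; have t0' := t0; have g0 := gap0; have g1 := gap1.
move=> [by_ Fy [x [m [yx mn rm Sx]]]]; exists m; split=> //.
have /andP[mr _] := rm.
have := birkhoff_same hT L0 fLip s0 mr yx Fy => H.
have H2 : `|S m x| <= `|S m y| + `|S m y - S m x|.
  have {1}-> : S m x = S m y - (S m y - S m x) by ring.
  exact: ler_normB.
lra.
Qed.

Lemma alarm_exceeds r : alarm r `<=` exceeds n t.
Proof.
have st' := st; have t0' := t0; have g0 := gap0; have g1 := gap1.
move=> y /alarm_above[m [mn _ h]]; exists m => //.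
by rewrite /above /=; lra.
Qed.

Lemma birkhoff_increment m r y : (m <= r)%N ->
  `|S r y - S m y| <= L * (r - m)%:R.
Proof.
move=> mr; have -> : r = (m + (r - m))%N by lia.
rewrite birkhoffD addrAC subrr add0r.
by rewrite (_ : (m + (r - m) - m = r - m)%N); [exact: birkhoff_le|lia].
Qed.

Lemma alarm_birkhoff r y : alarm r y -> 3 / 2 * t < `|S r y|.
Proof.
have st' := st; have t0' := t0; have g0 := gap0; have g1 := gap1.
move=> /alarm_above[m [mn /andP[mr rm] h]].
have H := birkhoff_increment y mr.
have H1 : L * (r - m)%:R <= L * s%:R by rewrite ler_pM2l// ler_nat; lia.
have H2 : `|S m y| <= `|S r y| + `|S r y - S m y|.
  have {1}-> : S m y = S r y - (S r y - S m y) by ring.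
  exact: ler_normB.
lra.
Qed.

(** The return [j] that follows the first time [tau] at which the sums exceed
    [2 t] raises the alarm, so that the first alarm comes no later, when the
    sums have not gone much beyond [2 t]. *)
Lemma first_alarm (y : X) : frequent (T:=T) s (n + s) y -> exceeds n (4 * t) y ->
  exists r, [/\ (r < n + s)%N, seqDU alarm r y &
    forall m, (m <= r)%N -> `|S m y| <= 2 * t + L * s%:R].
Proof.
have st' := st; have t0' := t0; have g0 := gap0; have g1 := gap1.
move=> Gy Ey.
have ex2 : exists m, (m <= n)%N && (2 * t < `|S m y|).
  have [m mn Sm] := Ey; exists m; rewrite mn /=.
  by rewrite /above /= in Sm; lra.
have [tau /andP[taun Stau] tau_min] := ex_minnP ex2.
have [j [tauj js bj]] : exists j, [/\ (tau <= j)%N, (j < tau + s)%N & base T (iter j T y)].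
  by apply: Gy; lia.
have Aj : alarm j y.
  split=> //; first by apply: frequent_le Gy; lia.
  exists y, tau; split=> //; first exact: (same_until_refl hT).
  by rewrite tauj ltnW.
have exA : exists r, `[< alarm r y >] by exists j; apply/asboolP.
have [r /asboolP Ar rmin] := ex_minnP exA.
have rj : (r <= j)%N by apply: rmin; apply/asboolP.
exists r; split; first by lia.
  split=> //; rewrite -bigcup_mkord => -[k /= kr Ak].
  by have := rmin k ltac:(exact/asboolP); lia.
move=> m mr.
have [mtau|taum] := ltnP m tau.
  have : ~~ ((m <= n)%N && (2 * t < `|S m y|)).
    by apply/negP => /tau_min; lia.
  have -> /= : (m <= n)%N by lia.
  by rewrite -leNgt; lra.
have tau_gt0 : (0 < tau)%N.
  case: tau Stau {tau_min taun tauj js Aj taum} => // .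
  by rewrite /birkhoff_sum big_ord0 normr0; lra.
have : ~~ ((tau.-1 <= n)%N && (2 * t < `|S tau.-1 y|)).
  by apply/negP => /tau_min; lia.
have -> /= : (tau.-1 <= n)%N by lia.
rewrite -leNgt => h.
have H := birkhoff_increment y (_ : tau.-1 <= m)%N.
have {}H := H ltac:(lia).
have H1 : L * (m - tau.-1)%:R <= L * s%:R by rewrite ler_pM2l// ler_nat; lia.
have H2 : `|S m y| <= `|S tau.-1 y| + `|S m y - S tau.-1 y|.
  have {1}-> : S m y = S tau.-1 y + (S m y - S tau.-1 y) by ring.
  exact: ler_normD.
lra.
Qed.

Variable D : R.
Hypothesis D0 : 0 < D.
Hypothesis qi : forall r (E B : set X), return_set (T:=T) r E -> measurable B ->
  B `<=` base T -> fine (mu (E `&` iter r T @^-1` B)) <= D * fine (mu E) * fine (mu B).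

(** After the first alarm the orbit starts afresh from the base: an event that
    concerns its future is quasi-independent of the alarm, and the first alarms
    at different times are disjoint events that imply that [t] is exceeded. *)
Lemma pr_after_alarm (A : set X) (B : nat -> set X) (beta : R) :
  measurable A -> (forall r, measurable (B r)) -> (forall r, B r `<=` base T) ->
  0 <= beta -> (forall r, fine (mu (B r)) <= beta) ->
  (forall y, A y -> frequent (T:=T) s (n + s) y ->
     exists r, [/\ (r < n + s)%N, seqDU alarm r y & B r (iter r T y)]) ->
  fine (mu A) <= fine (mu (~` [set x | frequent (T:=T) s (n + s) x])) +
    D * fine (mu (exceeds n t)) * beta.
Proof.
move=> mA mB Bb beta0 muB HA.
have mF r := measurable_return_set hT (return_set_first_alarm r).
pose V r := seqDU alarm r `&` iter r T @^-1` B r.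
have mV r : measurable (V r).
  by apply: measurableI; [exact: mF|exact: (measurable_iter_preimage hT)].
have mG := measurable_frequent s (n + s).
pose U := \big[setU/set0]_(r < n + s) V r.
have mU : measurable U by apply: bigsetU_measurable.
apply: (@le_trans _ _ (fine (mu (~` [set x | frequent (T:=T) s (n + s) x])) + fine (mu U))).
  apply: le_trans (prU_le (measurableC mG) mU).
  apply: le_pr => //; first by apply: measurableU => //; exact: measurableC.
  move=> y Ay; have [Gy|] := pselect (frequent (T:=T) s (n + s) y); last by left.
  right; have [r [rn Fr Br]] := HA y Ay Gy.
  by rewrite /U -bigcup_mkord; exists r.
rewrite lerD2l; apply: le_trans (pr_bigU_le _ mV) _.
apply: (@le_trans _ _ (\sum_(r < n + s) D * beta * fine (mu (seqDU alarm r)))).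
  apply: ler_sum => r _; apply: le_trans (qi (return_set_first_alarm r) (mB r) (Bb r)) _.
  rewrite mulrAC ler_wpM2r ?pr_ge0// ler_wpM2l//; exact: ltW.
rewrite -mulr_sumr mulrAC ler_wpM2r// ler_wpM2l ?(ltW D0)//.
rewrite -lee_fin -sumEFin.
under eq_bigr => r _ do rewrite -fineM_mu//.
rewrite -measure_bigsetU//.
rewrite -fineM_mu; last exact: measurable_exceeds.
apply: le_measure; rewrite ?inE.
- by apply: bigsetU_measurable.
- exact: measurable_exceeds.
- rewrite -bigcup_mkord => y [r _ [Ar _]]; exact: alarm_exceeds Ar.
Qed.

(** An inequality in the style of Hoffmann-Jorgensen. At the first alarm the
    sums are at most [5 t / 2], so that to exceed [4 t] they have to exceed [t]
    once more, for the orbit that starts afresh. *)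
Lemma exceeds_square : fine (mu (exceeds n (4 * t))) <=
  fine (mu (~` [set x | frequent (T:=T) s (n + s) x])) +
  D * fine (mu (exceeds n t)) ^+ 2.
Proof.
have st' := st; have t0' := t0; have g0 := gap0; have g1 := gap1.
rewrite expr2 mulrA.
have mB : measurable (base T `&` exceeds n t).
  by apply: measurableI; [exact: (measurable_base hT)|exact: measurable_exceeds].
apply: (pr_after_alarm (B := fun=> base T `&` exceeds n t)) => //.
- exact: measurable_exceeds.
- exact: pr_ge0.
- by move=> r; apply: le_pr => //; exact: measurable_exceeds.
move=> y Ey Gy; have [r [rn Fr Sr]] := first_alarm Gy Ey.
exists r; split=> //; have [[br _ _] _] := Fr; split=> //.
have [m mn Sm] := Ey; rewrite /above /= in Sm.
have rm : (r < m)%N.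
  by rewrite ltnNge; apply/negP => /Sr; lra.
exists (m - r)%N; first by lia.
rewrite /above /=.
have e : S m y = S r y + S (m - r)%N (iter r T y).
  by rewrite -birkhoffD subnKC// ltnW.
have := Sr r (leqnn r).
have : `|S m y| <= `|S r y| + `|S (m - r)%N (iter r T y)|.
  by rewrite e ler_normD.
lra.
Qed.

(** An inequality in the style of Ottaviani: at the first alarm the sum exceeds
    [3 t / 2], and it is unlikely to come back below [t / 2] at the time [n]. *)
Lemma exceeds_last (beta : R) :
  (forall m, (m <= n)%N -> fine (mu (above m (t / 2))) <= beta) ->
  fine (mu (exceeds n (4 * t))) <=
  fine (mu (~` [set x | frequent (T:=T) s (n + s) x])) + (D + 1) * beta.
Proof.
have st' := st; have t0' := t0; have g0 := gap0; have g1 := gap1.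
move=> Hb.
have beta0 : 0 <= beta by apply: le_trans (pr_ge0 _) (Hb 0%N _).
have mE := measurable_exceeds n (4 * t); have mA := measurable_above n (t / 2).
pose B r := base T `&` (if (r <= n)%N then above (n - r) (t / 2) else set0).
have mB r : measurable (B r).
  apply: measurableI; first exact: (measurable_base hT).
  by case: ifP => // _; exact: measurable_above.
have h : fine (mu (exceeds n (4 * t) `\` above n (t / 2))) <=
    fine (mu (~` [set x | frequent (T:=T) s (n + s) x])) +
    D * fine (mu (exceeds n t)) * beta.
  apply: (pr_after_alarm (B := B)) => //.
  - exact: measurableD.
  - by move=> r y [].
  - move=> r; rewrite /B; case: ifP => rn; last by rewrite setI0 measure0.
    apply: le_trans (Hb (n - r)%N (leq_subr _ _)).
    apply: le_pr => //; first by have := mB r; rewrite /B rn.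
    exact: measurable_above.
  move=> y [Ey nA] Gy; have [r [rn Fr Sr]] := first_alarm Gy Ey.
  exists r; split=> //; have [[br _ _] _] := Fr; split=> //.
  have [m mn Sm] := Ey; rewrite /above /= in Sm.
  have rm : (r < m)%N.
    by rewrite ltnNge; apply/negP => /Sr; lra.
  rewrite (_ : (r <= n)%N); last by lia.
  have {}nA : `|S n y| <= t / 2.
    by rewrite leNgt; apply/negP => H; apply: nA.
  have SR := alarm_birkhoff (proj1 Fr).
  have e : S n y = S r y + S (n - r)%N (iter r T y).
    by rewrite -birkhoffD subnKC//; lia.
  rewrite /above /=.
  have : `|S r y| <= `|S n y| + `|S (n - r)%N (iter r T y)|.
    have {1}-> : S r y = S n y - S (n - r)%N (iter r T y) by rewrite e; ring.
    exact: ler_normB.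
  lra.
have h2 : D * fine (mu (exceeds n t)) * beta <= D * beta.
  rewrite mulrAC ler_piMr ?mulr_ge0 ?(ltW D0)//.
  exact: pr_le1 (measurable_exceeds _ _).
have h3 : fine (mu (exceeds n (4 * t))) <=
    fine (mu (exceeds n (4 * t) `\` above n (t / 2))) + fine (mu (above n (t / 2))).
  apply: le_trans (prU_le _ mA); last exact: measurableD.
  apply: le_pr => //.
    by apply: measurableU => //; exact: measurableD.
  move=> y Ey; have [?|nA] := pselect (above n (t / 2) y); [by right|by left].
have := Hb n (leqnn n); lra.
Qed.

End Stopping.

End MaximalInequalities.

(** * Late returns *)

Section LateReturns.
Context {R : realType} {d : measure_display} {X : measurableType d}.
Context {mu : probability X R} {T : tower X} {rho : R}.
Hypothesis hT : young_tower mu T rho.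

(** A window of length [2 h] contains one of the form [k h, ..., k h + h - 1],
    so that only about [n / h] windows have to be considered; a union bound over
    all the windows would lose a factor [h]. *)
Lemma pr_late_return n h : (0 < h)%N ->
  fine (mu (~` [set x | frequent (T:=T) h.*2 (n + h.*2) x])) <=
  (n %/ h).+2%:R * fine (mu (avoid (T:=T) h)).
Proof.
move=> h0.
have mA := measurable_avoid hT h.
pose V k := iter (k * h) T @^-1` (avoid (T:=T) h).
have mV k : measurable (V k) by exact: (measurable_iter_preimage hT).
apply: (@le_trans _ _ (fine (mu (\big[setU/set0]_(k < (n %/ h).+2) V k)))).
  apply: le_pr.
  - by apply: measurableC; exact: (measurable_frequent hT).
  - exact: bigsetU_measurable.
  move=> x /= /existsNP[m /not_implyP[mn /forallNP nj]].
  rewrite -bigcup_mkord.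
  (* [k] is [m / h] rounded up *)
have e := divn_eq (m + h.-1) h.
  have lt := ltn_pmod (m + h.-1) h0.
  set k := ((m + h.-1) %/ h)%N in e.
  exists k => /=.
    have e2 := divn_eq n h; have lt2 := ltn_pmod n h0.
    rewrite ltnS leqNgt; apply/negP => kn.
    have : ((n %/ h).+2 * h <= k * h)%N by rewrite leq_mul2r kn orbT.
    rewrite !mulSn; lia.
  move=> j jh bj; apply: (nj (j + k * h)%N); split; [lia|lia|].
  by rewrite iterD.
apply: le_trans (pr_bigU_le _ mV) _.
under eq_bigr => k _ do rewrite (mu_iter_preimage hT _ mA).
by rewrite sumr_const card_ord mulr_natl.
Qed.

Variables (f : X -> R) (L : R).
Hypotheses (L0 : 0 < L) (fL : forall x, `|f x| <= L).
Hypothesis fLip : forall x y, same_level T x y -> `|f x - f y| <= L * tdist T rho x y.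
Variables (q C : R).
Hypotheses (hq : 1 < q) (hC : 0 < C).
Hypothesis htail : asymp_equiv (tail mu T) (fun n => C * n%:R `^ (- q)).

(** The windows are taken as long as the margin [t / 2] in the maximal
    inequalities allows, that is, of length proportional to [t]. *)
Lemma late_return_scale : exists t1 K : R, [/\ 0 < t1, 0 < K & forall n t,
  t1 <= t -> t <= L * n%:R -> exists s, [/\ (0 < s)%N,
    L * s%:R + L * s%:R / (1 - rho) <= t / 2 &
    fine (mu (~` [set x | frequent (T:=T) s (n + s) x])) <= K * (n%:R * t `^ (- q))]].
Proof.
have L0' := L0; have q1 := hq; have r1 := rho_lt1 hT.
have [K0 K00 HK0] := pr_avoid_le hT hq hC htail.
pose g := (1 - rho)^-1.
have g0 : 0 < g by rewrite invr_gt0 subr_gt0.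
(* the margin allows windows of length [2 h] as long as [h k <= t] *)
pose k := 4 * L * (1 + g).
have k0 : 0 < k by rewrite !mulr_gt0// addr_gt0.
pose c := L / k.
have c0 : 0 < c by exact: divr_gt0.
pose K := (1 + 2 * c) * K0 * (2 * k) `^ q.
have K1 : 0 < K by rewrite !mulr_gt0 ?powR_gt0//; lra.
exists k, K; split=> // n t kt tn.
have t0 : 0 < t by exact: lt_le_trans kt.
pose h := Num.trunc (t / k).
have tk1 : 1 <= t / k by rewrite ler_pdivlMr// mul1r.
have /andP[ht ht'] : h%:R <= t / k < h.+1%:R.
  by apply: Num.Theory.truncn_itv; lra.
have h0 : (0 < h)%N.
  by rewrite lt0n; apply/eqP => h0; rewrite h0 in ht'; lra.
have hr0 : 1 <= h%:R :> R by rewrite ler1n.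
exists h.*2; split; first by rewrite double_gt0.
  have -> : (h.*2%:R : R) = 2 * h%:R by rewrite -mul2n natrM.
  have : h%:R * k <= t by rewrite -ler_pdivlMr.
  by rewrite /k -/g; lra.
apply: le_trans (pr_late_return n h0) _.
apply: le_trans (ler_wpM2l (ler0n _ _) (HK0 h h0)) _.
have hn : h%:R <= c * n%:R.
  apply: le_trans ht _; rewrite /c mulrAC ler_pM2r ?invr_gt0//.
have e1 : (n %/ h).+2%:R <= (1 + 2 * c) * (n%:R / h%:R).
  have : (n %/ h)%:R <= n%:R / h%:R :> R.
    by rewrite ler_pdivlMr ?ltr0n// -natrM ler_nat leq_trunc_div.
  have : 1 <= c * (n%:R / h%:R) by rewrite mulrA ler_pdivlMr ?ltr0n// mul1r.
  rewrite -!natr1; lra.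
have p0 : 0 <= h%:R `^ (1 - q) :> R by exact: powR_ge0.
have p1 : 0 <= K0 * h%:R `^ (1 - q) by rewrite mulr_ge0// ltW.
apply: le_trans (ler_wpM2r p1 e1) _.
have -> : (1 + 2 * c) * (n%:R / h%:R) * (K0 * h%:R `^ (1 - q)) =
    (1 + 2 * c) * K0 * (n%:R * h%:R `^ (- q)).
  have -> : h%:R `^ (1 - q) = h%:R * h%:R `^ (- q) :> R.
    rewrite -{2}(@powRr1 _ h%:R)// -powRD//.
    by rewrite pnatr_eq0 -lt0n h0 implybT.
  by field; lra.
rewrite /K -!mulrA ler_pM2l; last by lra.
rewrite ler_pM2l// mulrCA ler_wpM2l//.
rewrite !powRN.
have hp : 0 < h%:R `^ q :> R by rewrite powR_gt0 ?ltr0n.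
have tp : 0 < t `^ q by rewrite powR_gt0.
rewrite -[_^-1]mul1r ler_pdivrMr// mulrAC ler_pdivlMr// mul1r.
rewrite -powRM//; last by lra.
have t2 : t <= 2 * k * h%:R.
  have : t < h.+1%:R * k by rewrite -ltr_pdivrMr.
  have := ler_wpM2r (ltW k0) hr0.
  by rewrite -natr1; lra.
have kh : 0 <= 2 * k * h%:R by lra.
by apply: ge0_ler_powR; rewrite ?nnegrE//; lra.
Qed.

Lemma exceeds_large n t : L * n%:R <= t -> fine (mu (exceeds (T:=T) f n t)) = 0.
Proof.
move=> nt; rewrite (_ : exceeds _ _ _ = set0) ?measure0//.
apply/seteqP; split=> // x [m mn]; rewrite /above /=.
have := birkhoff_le fL (T:=T) m x.
have : L * m%:R <= L * n%:R by rewrite ler_pM2l// ler_nat.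
lra.
Qed.

Lemma exceeds_recursion : exists t1 K D : R, [/\ 0 < t1, 0 < K, 0 < D &
  forall n t, t1 <= t -> t <= L * n%:R ->
    fine (mu (exceeds (T:=T) f n (4 * t))) <=
      K * (n%:R * t `^ (- q)) + D * fine (mu (exceeds (T:=T) f n t)) ^+ 2 /\
    forall beta,
      (forall m, (m <= n)%N -> fine (mu (above (T:=T) f m (t / 2))) <= beta) ->
      fine (mu (exceeds (T:=T) f n (4 * t))) <= K * (n%:R * t `^ (- q)) + (D + 1) * beta].
Proof.
have [D D0 qi] := quasi_independence hT.
have [t1 [K [t10 K0 H]]] := late_return_scale.
exists t1, K, D; split=> // n t t1t tn.
have t0 : 0 < t by exact: lt_le_trans t1t.
have [s [s0 st late]] := H n t t1t tn.
split=> [|beta Hb].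
  apply: le_trans (exceeds_square hT L0 fL fLip n s0 t0 st D0 qi) _.
  by rewrite lerD2r.
apply: le_trans (exceeds_last hT L0 fL fLip s0 t0 st D0 qi Hb) _.
by rewrite lerD2r.
Qed.

End LateReturns.

(** * From tightness to a weak-type bound *)

Section WeakType.
Context {R : realType}.

(** The second inequality of the recursion turns tightness, that is, the
    smallness of [Ab] at large multiples of [a n], into that of [Ex]. There, the
    quadratic term of the first one is at most a small multiple of [Ex n t], so
    that a bound of order [(a n / t) ^ p] propagates from [t] to [4 t]. *)
Lemma weak_type_bootstrap (Ex Ab : nat -> R -> R) (a : nat -> R)
    (L t1 K D q p C' : R) (N : nat) :
  (forall n t, 0 <= Ex n t <= 1) ->
  (forall n t, L * n%:R <= t -> Ex n t = 0) ->
  (forall n t t', t <= t' -> Ab n t' <= Ab n t) ->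
  0 < t1 -> 0 < K -> 0 < D -> 0 < p -> 0 < C' ->
  (forall n t, t1 <= t -> t <= L * n%:R ->
    Ex n (4 * t) <= K * (n%:R * t `^ (- q)) + D * Ex n t ^+ 2 /\
    forall beta, (forall m, (m <= n)%N -> Ab m (t / 2) <= beta) ->
      Ex n (4 * t) <= K * (n%:R * t `^ (- q)) + (D + 1) * beta) ->
  (forall e, 0 < e -> exists2 K0, 0 < K0 & exists N, forall n, (N <= n)%N ->
     forall m, (m <= n)%N -> Ab m (K0 * a n) <= e) ->
  (forall c, exists N, forall n, (N <= n)%N -> c <= a n) ->
  (forall n, (N <= n)%N -> forall t, 0 < t -> t <= L * n%:R ->
     n%:R * t `^ (- q) <= C' * (a n / t) `^ p) ->
  exists2 A, 0 < A & exists N', forall n, (N' <= n)%N -> forall t, 0 < t ->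
    Ex n t <= A * (a n / t) `^ p.
Proof.
move=> Ex01 Ex0 Ab_le t10 K0 D0 p0 C0 rec tight a_oo scale.
pose F := 4 `^ p : R.
have F0 : 0 < F by apply: powR_gt0; lra.
(* [D * delta] compensates half of the loss [4 ^ p] from [t] to [4 t] *)
pose delta := (2 * D * F)^-1.
have d0 : 0 < delta by rewrite invr_gt0 !mulr_gt0.
have D10 : 0 < D + 1 by lra.
pose eps := delta / (2 * (D + 1)).
have e0 : 0 < eps by rewrite divr_gt0// mulr_gt0.
have [Ka Ka0 [Na HNa]] := tight _ e0.
(* for [t >= Kb * a n] the linear term is at most [delta / 2] *)
pose Kb := (2 * K * C' / delta) `^ p^-1.
have B0 : 0 < 2 * K * C' / delta by rewrite divr_gt0// !mulr_gt0.
have Kb0 : 0 < Kb by rewrite powR_gt0.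
have KbE : Kb `^ p = 2 * K * C' / delta.
  by rewrite -powRrM mulVf ?gt_eqF// powRr1// ltW.
pose M := 2 * Ka + Kb.
have M0 : 0 < M by rewrite /M; lra.
have [Nb HNb] := a_oo (t1 / M + 1).
(* the first term makes the bound trivial for [t <= 16 M a n], the second one
   absorbs the linear term of the recursion *)
pose A := (16 * M) `^ p + 2 * F * (K * C').
have KC0 : 0 < K * C' by rewrite mulr_gt0.
have A0 : 0 < A.
  by apply: addr_gt0; [apply: powR_gt0; lra|apply: mulr_gt0 => //; lra].
exists A => //; exists (maxn N (maxn Na Nb)) => n.
rewrite !geq_max => /andP[nN /andP[nNa nNb]].
have an := HNb n nNb.
have an0 : 0 < a n.
  by apply: lt_le_trans an; rewrite ltr_wpDl// ltW// divr_gt0.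
have Man : t1 <= M * a n.
  by rewrite mulrC -ler_pdivrMr//; apply: le_trans an; rewrite lerDl.
pose t0 := M * a n.
have t00 : 0 < t0 by rewrite mulr_gt0.
have rhs0 t : 0 < t -> 0 < (a n / t) `^ p by move=> t_0; rewrite powR_gt0// divr_gt0.
have small t : t0 <= t -> Ex n (4 * t) <= delta.
  move=> t0t; have t_0 : 0 < t by exact: lt_le_trans t0t.
  have [tn|nt] := lerP t (L * n%:R); last by rewrite Ex0 ?(ltW d0)//; lra.
  have [_ /(_ eps)] := rec n t (le_trans Man t0t) tn.
  move=> H; apply: (le_trans (H _)).
    move=> m mn; apply: le_trans (HNa n nNa m mn); apply: Ab_le.
    have : 2 * Ka * a n <= t0 by rewrite /t0 ler_pM2r// /M; lra.
    by lra.
  have e1 : (D + 1) * eps = delta / 2 by rewrite /eps; field; lra.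
  have e2 : K * (n%:R * t `^ (- q)) <= delta / 2.
    apply: (le_trans (ler_wpM2l (ltW K0) (scale n nN t t_0 tn))).
    have h : (a n / t) `^ p <= (Kb^-1) `^ p.
      apply: ge0_ler_powR; rewrite ?nnegrE ?(ltW p0) ?divr_ge0 ?invr_ge0 ?(ltW an0) ?(ltW t_0) ?(ltW Kb0)//.
      rewrite ler_pdivrMr// mulrC ler_pdivlMr//.
      apply: le_trans t0t; rewrite /t0 mulrC ler_pM2r// /M; lra.
    apply: (le_trans (ler_wpM2l (ltW K0) (ler_wpM2l (ltW C0) h))).
    rewrite -powR_inv1 ?(ltW Kb0)// -powRrM mulN1r powRN KbE.
    rewrite le_eqVlt; apply/orP; left; apply/eqP.
    by field; rewrite !gt_eqF.
  lra.
have ind k t : 0 < t -> t <= 4 ^+ k * (16 * t0) -> Ex n t <= A * (a n / t) `^ p.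
  elim: k t => [|k IHk] t t_0 tk.
    have /andP[_ /le_trans] := Ex01 n t; apply.
    rewrite expr0 mul1r in tk.
    have h : (16 * M)^-1 <= a n / t.
      rewrite ler_pdivlMr// mulrC ler_pdivrMr ?mulr_gt0//.
      by apply: le_trans tk _; rewrite /t0; lra.
    have h2 : ((16 * M)^-1) `^ p <= (a n / t) `^ p.
      by apply: ge0_ler_powR; rewrite ?nnegrE ?(ltW p0)// ?invr_ge0 ?divr_ge0 ?mulr_ge0 ?(ltW an0) ?(ltW t_0) ?(ltW M0).
    have m0 : 0 < (16 * M) `^ p by rewrite powR_gt0 ?mulr_gt0.
    have : (16 * M) `^ p * ((16 * M)^-1) `^ p <= A * (a n / t) `^ p.
      apply: ler_pM => //; try exact: powR_ge0.
      by rewrite /A lerDl !mulr_ge0 ?ltW.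
    rewrite -powRM ?invr_ge0 ?mulr_ge0 ?(ltW M0)//.
    by rewrite divff ?powR1// gt_eqF ?mulr_gt0.
  have [small_t|big] := lerP t (16 * t0).
    apply: IHk => //; apply: le_trans small_t _.
    by rewrite ler_peMl ?exprn_ege1 ?ler1n// mulr_ge0 ?ltW.
  have [t' tE] : exists t', t = 4 * t' by exists (t / 4); lra.
  have t'0 : 0 < t' by lra.
  have [tn|nt] := lerP t' (L * n%:R); last first.
    by rewrite Ex0 ?mulr_ge0 ?powR_ge0 ?(ltW A0)//; lra.
  have IH : Ex n t' <= A * (a n / t') `^ p.
    by apply: IHk => //; rewrite tE exprS in tk; lra.
  have Ed : Ex n t' <= delta.
    have -> : t' = 4 * (t' / 4) by lra.
    by apply: small; lra.
  have t1t' : t1 <= t' by apply: (le_trans Man); rewrite -/t0; lra.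
  have [h _] := rec n t' t1t' tn.
  rewrite tE; apply: (le_trans h).
  set Y := (a n / t') `^ p in IH *.
  have Y0 : 0 < Y by exact: rhs0.
  have YE : (a n / (4 * t')) `^ p = Y / F.
    have -> : a n / (4 * t') = (a n / t') * 4^-1 by field; lra.
    rewrite powRM ?invr_ge0// ?(ltW (divr_gt0 an0 t'0))//.
    by congr (_ * _); rewrite -powR_inv1// -powRrM mulN1r powRN.
  have h1 : K * (n%:R * t' `^ (- q)) <= K * C' * Y.
    by rewrite -mulrA ler_pM2l//; exact: scale.
  have h2 : D * Ex n t' ^+ 2 <= D * delta * (A * Y).
    rewrite expr2 -mulrA ler_pM2l//; apply: ler_pM => //.
    - by have /andP[] := Ex01 n t'.
    - by have /andP[] := Ex01 n t'.
  have h3 : D * delta * (A * Y) = A * Y / F / 2.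
    by rewrite /delta; field; rewrite !gt_eqF.
  have h4 : K * C' * Y <= A * Y / F / 2.
    have -> : K * C' * Y = (2 * F * (K * C')) * Y / F / 2.
      by field; rewrite gt_eqF.
    by rewrite !ler_pM2r ?invr_gt0// /A lerDr powR_ge0.
  rewrite YE; have : A * Y / F = A * (Y / F) by rewrite mulrA.
  lra.
move=> t t_0.
have pos : 0 < 16 * t0 by lra.
apply: (ind (Num.truncn (t / (16 * t0))).+1) => //.
rewrite -ler_pdivrMr//.
apply: le_trans (ltW (truncnS_gt _)) _.
by rewrite -natrX ler_nat ltnW// ltn_expl.
Qed.

End WeakType.

(** * Normalizing sequences *)

Section Normalization.
Context {R : realType}.
Variable q : R.
Hypothesis hq : 1 < q.

(** [e <= 4], from [1 - 1/2 <= exp (- 1/2)]. *)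
Lemma ln_natr_ge1 n : (4 <= n)%N -> 1 <= ln (n%:R : R).
Proof.
move=> n4; have n0 : 0 < n%:R :> R by rewrite ltr0n; lia.
rewrite -(@ler_expR R) lnK ?posrE//.
apply: (@le_trans _ _ 4); last by rewrite ler_nat.
have h := expR_ge1Dx (- 2^-1 : R).
have e0 := expR_gt0 (2^-1 : R).
have e : expR (2^-1 : R) <= 2.
  have e1 : expR (2^-1 : R) * expR (- 2^-1) = 1 by rewrite -expRD subrr expR0.
  have := ler_wpM2l (ltW e0) h; rewrite e1; lra.
have -> : expR 1 = expR (2^-1 : R) * expR 2^-1 by rewrite -expRD; congr expR; lra.
by rewrite (_ : 4 = 2 * 2); [apply: ler_pM; rewrite ?(ltW e0)|lra].
Qed.

Lemma normalization_le m n : (m <= n)%N -> normalization q m <= normalization q n.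
Proof.
move=> mn; rewrite /normalization.
have mn' : m%:R <= n%:R :> R by rewrite ler_nat.
case: ifP => // _.
  by apply: ge0_ler_powR; rewrite ?nnegrE ?invr_ge0.
case: ifP => // _; last first.
  apply: ge0_ler_powR; rewrite ?nnegrE ?invr_ge0//.
  by rewrite ltW// (lt_trans _ hq).
have lnn k : 0 <= ln (k%:R : R).
  case: k => [|k]; first by rewrite ln0.
  by apply: ln_ge0; rewrite ler1n.
case: m mn mn' => [|m] mn mn'.
  rewrite mul0r powR0 ?powR_ge0// invr_neq0//.
apply: ge0_ler_powR; rewrite ?nnegrE ?invr_ge0 ?mulr_ge0//.
apply: ler_pM => //; rewrite ler_ln ?posrE ?ltr0n//; lia.
Qed.

Lemma normalization_ge : exists2 r : R, 0 < r &
  forall n, (4 <= n)%N -> n%:R `^ r <= normalization q n.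
Proof.
rewrite /normalization; have q0 : 0 < q by exact: lt_trans hq.
have [_|_] := boolP (2 < q); first by exists 2^-1; rewrite ?invr_gt0.
have [_|_] := boolP (q == 2); last by exists q^-1; rewrite ?invr_gt0.
exists 2^-1; rewrite ?invr_gt0// => n n4.
have l1 := ln_natr_ge1 n4.
apply: ge0_ler_powR; rewrite ?nnegrE ?invr_ge0 ?mulr_ge0//; first by lra.
by rewrite ler_peMr.
Qed.

Lemma normalization_infty c : exists N, forall n, (N <= n)%N -> c <= normalization q n.
Proof.
have [r r0 Hr] := normalization_ge.
pose b := Num.max c 1; have b1 : 1 <= b by rewrite le_max lexx orbT.
exists (maxn 4 (Num.truncn (b `^ r^-1)).+1) => n.
rewrite geq_max => /andP[n4 nb].
apply: le_trans (Hr n n4); apply: (@le_trans _ _ b); first by rewrite le_max lexx.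
have -> : b = (b `^ r^-1) `^ r.
  by rewrite -powRrM mulVf ?gt_eqF// powRr1//; lra.
apply: ge0_ler_powR; rewrite ?nnegrE ?powR_ge0 ?(ltW r0)//.
apply: le_trans (ltW (truncnS_gt _)) _.
by rewrite ler_nat.
Qed.

(** The left-hand side is the order of the probability of a late return. For
    [q > 2] the quotient of the two sides is a power [q - 2] of [t / n], which
    is bounded in the range of the sums; for [q <= 2] the exponents of [t] agree
    and the inequality says that [a n ^ q] is at least [n]. *)
Lemma normalization_scale (L : R) : 0 < L -> exists2 C', 0 < C' &
  forall n, (4 <= n)%N -> forall t, 0 < t -> t <= L * n%:R ->
    n%:R * t `^ (- q) <= C' * (normalization q n / t) `^ critical_exponent q.
Proof.
move=> L0; rewrite /normalization /critical_exponent.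
have [q2|q2] := ltP 2 q.
  rewrite (ltW q2).
  exists (L `^ (q - 2)); first exact: powR_gt0.
  move=> n n4 t t0 tn.
  have n0 : 0 < n%:R :> R by rewrite ltr0n; lia.
  rewrite powRM ?powR_ge0 ?invr_ge0 ?(ltW t0)//.
  rewrite -powRrM -(powR_inv1 (ltW t0)) -powRrM.
  have -> : 2^-1 * (2 * q - 2) = q - 1 by lra.
  have -> : -1 * (2 * q - 2) = - q - (q - 2) by lra.
  rewrite (@powRB _ t (- q) (q - 2)); last by rewrite (gt_eqF t0) implybT.
  have -> : n%:R `^ (q - 1) = n%:R * n%:R `^ (q - 2) :> R.
    rewrite -{2}(@powRr1 _ n%:R)// -powRD; last by rewrite (gt_eqF n0) implybT.
    by congr (_ `^ _); lra.
  have tq := powR_gt0 (- q) t0; have tq2 := powR_gt0 (q - 2) t0.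
  have -> : L `^ (q - 2) * (n%:R * n%:R `^ (q - 2) * (t `^ (- q) / t `^ (q - 2))) =
    (n%:R * t `^ (- q)) * ((L * n%:R) `^ (q - 2) / t `^ (q - 2)).
    by rewrite powRM ?(ltW L0)//; ring.
  rewrite ler_peMr ?mulr_ge0 ?powR_ge0// ler_pdivlMr// mul1r.
  by apply: ge0_ler_powR => //; rewrite ?nnegrE ?subr_ge0 ?(ltW q2) ?mulr_ge0 ?(ltW t0) ?(ltW L0).
exists 1 => // n n4 t t0 tn; rewrite mul1r.
have n0 : 0 < n%:R :> R by rewrite ltr0n; lia.
have [->|nq2] := eqVneq q 2; last first.
  have -> : (2 <= q) = false by rewrite leNgt lt_neqAle nq2 q2.
  rewrite powRM ?powR_ge0 ?invr_ge0 ?(ltW t0)// -powRrM mulVf; last by rewrite gt_eqF// (lt_trans _ hq).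
  by rewrite powRr1// -(powR_inv1 (ltW t0)) -powRrM mulN1r.
rewrite lexx.
have -> : 2 * 2 - 2 = 2 :> R by lra.
have l1 := ln_natr_ge1 n4.
have l0 : 0 <= n%:R * ln (n%:R : R) by rewrite mulr_ge0//; lra.
rewrite powRM ?powR_ge0 ?invr_ge0 ?(ltW t0)// -powRrM mulVf ?pnatr_eq0//.
rewrite powRr1// -(powR_inv1 (ltW t0)) -powRrM mulN1r.
by rewrite ler_wpM2r ?powR_ge0// ler_peMr.
Qed.

End Normalization.

(** * Convergence of moments from a weak-type bound *)

Section Moments.
Context {R : realType}.

(** Away from zero the power is differentiable; at zero continuity holds because
    the exponent is positive. *)
Lemma continuous_normr_powR (p : R) : 0 < p ->
  continuous (fun x : R => `|x| `^ p).
Proof.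
move=> p0 x; have [->|x0] := eqVneq x 0.
  rewrite /continuous_at normr0 powR0 ?gt_eqF//.
  apply/cvgrPdist_lt => e e0.
  have r0 : 0 < e `^ p^-1 by exact: powR_gt0.
  exists (e `^ p^-1) => //= y; rewrite /= !sub0r !normrN => yr.
  rewrite ger0_norm ?powR_ge0//.
  have -> : e = (e `^ p^-1) `^ p by rewrite -powRrM mulVf ?gt_eqF// powRr1// ltW.
  by apply: gt0_ltr_powR; rewrite // nnegrE// ltW.
apply: (@continuous_comp _ _ _ (fun y : R => `|y|) (fun y : R => y `^ p)).
  exact: norm_continuous.
apply: differentiable_continuous; apply/derivable1_diffP.
by apply: derivable_powR; rewrite in_itv /= andbT normr_gt0.
Qed.

Context {d : measure_display} {X : measurableType d} (P : probability X R).

Lemma mu_le_integral (A : set X) (h : X -> R) : measurable A ->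
  measurable_fun setT h -> (forall x, 0 <= h x) -> (forall x, A x -> 1 <= h x) ->
  (P A <= \int[P]_x (h x)%:E)%E.
Proof.
move=> mA mh h0 Ah.
rewrite -(setIT A) -integral_indic//; apply: ge0_le_integral => //.
- by apply/measurable_EFinP; exact: measurable_indic.
- by apply/measurable_EFinP.
move=> x _; rewrite lee_fin indicE; case: (boolP (x \in A)) => [|_]; last exact: h0.
by rewrite inE => /Ah.
Qed.

Lemma le_integral_probability (h1 h2 : X -> R) :
  measurable_fun setT h1 -> measurable_fun setT h2 -> (forall x, 0 <= h1 x) ->
  (forall x, h1 x <= h2 x) ->
  (\int[P]_x (h1 x)%:E <= \int[P]_x (h2 x)%:E)%E.
Proof.
move=> m1 m2 h1_0 h12.
apply: ge0_le_integral => //; try by apply/measurable_EFinP.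
- by move=> x _; rewrite lee_fin.
- by move=> x _; rewrite lee_fin.
Qed.

Lemma integral_bounded_fin (h : X -> R) (b : R) :
  measurable_fun setT h -> (forall x, 0 <= h x <= b) ->
  (\int[P]_x (h x)%:E \is a fin_num)%E.
Proof.
move=> mh hb.
have h0 x : 0 <= h x by have /andP[] := hb x.
rewrite ge0_fin_numE; last by apply: integral_ge0 => x _; rewrite lee_fin.
apply: (@le_lt_trans _ _ (\int[P]_x (cst b%:E x))%E).
  by apply: le_integral_probability => // x; have /andP[] := hb x.
rewrite integral_cst//; apply: (@le_lt_trans _ _ (b%:E * 1)%E); last by rewrite mule1 ltry.
apply: lee_wpmul2l; last exact: probability_le1.
by rewrite lee_fin; have /andP[h0b hb_] := hb point; exact: le_trans hb_.
Qed.

Lemma measurable_norm_gt (Y : X -> R) (t : R) : measurable_fun setT Y ->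
  measurable [set x | t < `|Y x|].
Proof.
move=> mY.
have mS : measurable_fun setT (fun x => `|Y x|).
  by apply: measurableT_comp; [exact: normr_measurable|].
have := mS measurableT `]t, +oo[%classic (measurable_itv _).
rewrite setTI; congr (measurable _); apply/seteqP; split=> x;
by rewrite /= in_itv /= andbT.
Qed.

End Moments.

Lemma telescope_step (R : realFieldType) (a b c u v w : R) :
  b <= a + c * (u - v) -> b + c * (v - w) <= a + c * (u - w).
Proof. lra. Qed.

Lemma half_error_sum (R : realFieldType) (a b c e u v w : R) :
  u < a + e / 2 -> b - e / 2 < v -> a <= b + w -> w <= c -> u <= e + (v + c).
Proof. lra. Qed.

Section Convergence.
Context {R : realType} {d d' : measure_display} {X : measurableType d}
  {P : probability X R} {Om : measurableType d'} {Q : probability Om R}.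
Variables (Y : nat -> X -> R) (Z : {RV Q >-> R}).
Hypothesis mY : forall n, measurable_fun setT (Y n).
Hypothesis hcvg : cvg_in_distribution P Y Z.

Let mZ : measurable_fun setT Z := measurable_funP Z.

Lemma cvg_bounded_continuous (g : R -> R) : continuous g ->
  (exists M : R, forall x, `|g x| <= M) ->
  (\int[P]_x (g (Y n x))%:E @[n --> \oo] --> \int[Q]_w (g (Z w))%:E)%E.
Proof. by move=> cg bg; have := hcvg cg bg; rewrite unlock. Qed.

(** The indicator of a tail is compared from both sides with a bounded
    continuous ramp that rises from [0] to [1] between [k] and [k + 1]. *)
Lemma cvg_in_distribution_tight (e : R) : 0 < e -> exists2 K : R, 0 < K &
  exists N, forall n, (N <= n)%N -> fine (P [set x | K < `|Y n x|]) <= e.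
Proof.
move=> e0.
pose F k := [set w | k%:R < `|Z w|].
have mF k : measurable (F k) by exact: measurable_norm_gt.
have F0 : \bigcap_k F k = set0.
  apply/seteqP; split=> // w Fw.
  have := Fw (Num.truncn `|Z w|).+1 Logic.I.
  by rewrite /F /= ltNge (ltW (truncnS_gt _)).
have : Q \o F @ \oo --> Q (\bigcap_k F k).
  apply: nonincreasing_cvg_mu => //.
  - by rewrite (le_lt_trans (probability_le1 Q (mF _)))// ltry.
  - by rewrite F0.
  - move=> m n mn; apply/subsetPset => w; rewrite /F /=; apply: le_lt_trans.
    by rewrite ler_nat.
rewrite F0 measure0 => /fine_cvgP[_ /cvgrPdist_lt /(_ e e0)[k _ /(_ k (leqnn k))]].
rewrite /= sub0r normrN ger0_norm ?fine_ge0// => QF.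
pose g (x : R) : R := Num.min (Num.max (`|x| - k%:R) 0) 1.
have cg : continuous g.
  move=> x.
  apply: (@continuous_min R R (fun x => Num.max (`|x| - k%:R) 0) (fun=> 1) x);
    last exact: cst_continuous.
  apply: (@continuous_max R R (fun x => `|x| - k%:R) (fun=> 0) x);
    last exact: cst_continuous.
  apply: continuousB; last exact: cst_continuous.
  exact: norm_continuous.
have g0 x : 0 <= g x by rewrite /g le_min le_max lexx orbT ler01.
have g1 x : g x <= 1 by rewrite /g ge_min lexx orbT.
have mg := continuous_measurable_fun cg.
have mgY n : measurable_fun setT (g \o Y n) by exact: measurableT_comp.
have mgZ : measurable_fun setT (g \o Z) by exact: measurableT_comp.
have bg : exists M : R, forall x, `|g x| <= M.
  by exists 1 => x; rewrite ger0_norm.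
have finY n : (\int[P]_x (g (Y n x))%:E \is a fin_num)%E.
  by apply: (@integral_bounded_fin _ _ _ _ _ 1) => [|x]; [exact: mgY|rewrite g0 g1].
have finZ : (\int[Q]_x (g (Z x))%:E \is a fin_num)%E.
  by apply: (@integral_bounded_fin _ _ _ _ _ 1) => [|x]; [exact: mgZ|rewrite g0 g1].
have EZ : fine (\int[Q]_x (g (Z x))%:E)%E < e.
  apply: le_lt_trans QF; rewrite -lee_fin fineK//.
  rewrite fineK ?fin_num_measure//.
  rewrite -(setIT (F k)) -integral_indic//.
  apply: le_integral_probability => // x.
  rewrite indicE; case: (boolP (x \in F k)) => [_|]; first exact: g1.
  rewrite notin_setE /F /= => /negP; rewrite -leNgt => Zk.
  by rewrite /g ge_min ge_max lexx subr_le0 Zk.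
have := cvg_bounded_continuous cg bg.
rewrite -(fineK finZ) => /fine_cvgP[_ /cvgrPdist_lt].
have de : 0 < e - fine (\int[Q]_x (g (Z x))%:E)%E by rewrite subr_gt0.
move=> /(_ _ de)[N _ HN].
exists (k%:R + 1); first by rewrite ltr_wpDl.
exists N => n Nn.
have := HN n Nn; rewrite /= distrC ltr_distl => /andP[_ h].
have {}h : fine (\int[P]_x (g (Y n x))%:E)%E < e by rewrite addrCA subrr addr0 in h.
apply: le_trans (ltW h).
have mA := measurable_norm_gt (k%:R + 1) (mY n).
rewrite -lee_fin !fineK ?fin_num_measure//.
apply: mu_le_integral => //; first exact: mgY.
move=> x /=.
rewrite /g => h1; rewrite le_min lexx andbT le_max lerBrDl ltW//.
Qed.

Variables (p p' A : R) (N : nat).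
Hypotheses (p0 : 0 < p) (pp : p < p') (A0 : 0 < A).
Hypothesis bY : forall n, exists B : R, forall x, `|Y n x| <= B.
Hypothesis weak : forall n, (N <= n)%N -> forall t, 0 < t ->
  fine (P [set x | t < `|Y n x|]) <= A * t `^ (- p').

(** Truncation at dyadic heights: these functions are bounded and continuous, and
    the error made between two heights is controlled by one weak-type bound. *)
Definition truncated_power k (x : R) : R := Num.min (`|x| `^ p) ((2 ^+ k) `^ p).
Local Notation tp := truncated_power.

Lemma pow2_powR (r : R) k : ((2 : R) ^+ k) `^ r = (2 `^ r) ^+ k.
Proof.
elim: k => [|k IHk]; first by rewrite !expr0 powR1.
by rewrite !exprS powRM ?exprn_ge0// IHk.
Qed.

Lemma truncated_power_ge0 k x : 0 <= tp k x.
Proof. by rewrite le_min !powR_ge0. Qed.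

Lemma truncated_power_le k x : tp k x <= (2 ^+ k) `^ p.
Proof. by rewrite ge_min lexx orbT. Qed.

Lemma truncated_power_eq k x : `|x| <= 2 ^+ k -> tp k x = `|x| `^ p.
Proof.
move=> xk; apply/min_idPl; apply: ge0_ler_powR => //; first exact: ltW.
by rewrite nnegrE exprn_ge0.
Qed.

Lemma truncated_power_mono x k k' : (k <= k')%N -> tp k x <= tp k' x.
Proof.
move=> kk; rewrite /tp le_min ge_min lexx /= ge_min.
apply/orP; right; apply: ge0_ler_powR; rewrite ?nnegrE ?exprn_ge0 ?(ltW p0)//.
by rewrite ler_eXn2l// ltr1n.
Qed.

Lemma continuous_truncated_power k : continuous (tp k).
Proof.
move=> x.
apply: (@continuous_min R R (fun x => `|x| `^ p) (fun=> (2 ^+ k) `^ p) x);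
  last exact: cst_continuous.
exact: continuous_normr_powR.
Qed.

Let theta : R := 2 `^ (p - p').
Let c : R := 2 `^ p * A / (1 - theta).

Lemma theta_itv : 0 < theta < 1.
Proof.
have l2 : 0 < ln (2 : R) by rewrite ln_gt0// ltr1n.
rewrite /theta powR_gt0//= -[X in _ < X](@powRr0 _ 2).
by rewrite /powR pnatr_eq0 /= ltr_expR ltr_pM2r// subr_lt0.
Qed.

Let c_ge0 : 0 <= c.
Proof.
have /andP[_ t1] := theta_itv.
by rewrite divr_ge0 ?mulr_ge0 ?powR_ge0 ?(ltW A0)// subr_ge0 ltW.
Qed.

Lemma measurable_truncated_power k (dU : measure_display) (U : measurableType dU)
    (V : U -> R) :
  measurable_fun setT V -> measurable_fun setT (tp k \o V).
Proof.
move=> mV; apply: measurableT_comp => //.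
exact: continuous_measurable_fun (@continuous_truncated_power k).
Qed.

Let m n k : R := fine (\int[P]_x (tp k (Y n x))%:E)%E.

Let mfin n k : (\int[P]_x (tp k (Y n x))%:E)%E = (m n k)%:E.
Proof.
rewrite fineK//; apply: (@integral_bounded_fin _ _ _ _ _ ((2 ^+ k) `^ p)).
  exact: (measurable_truncated_power k (mY n)).
by move=> x; rewrite truncated_power_ge0 truncated_power_le.
Qed.

Lemma truncated_moment_step n k : (N <= n)%N ->
  m n k.+1 <= m n k + 2 `^ p * A * theta ^+ k.
Proof.
move=> Nn.
pose B : R := (2 ^+ k.+1) `^ p.
have B0 : 0 <= B by exact: powR_ge0.
pose E := [set x | 2 ^+ k < `|Y n x|].
have mE : measurable E by exact: measurable_norm_gt.
have mI : measurable_fun setT (\1_E : X -> R) by exact: measurable_indic.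
have mtp k' := measurable_truncated_power k' (mY n).
have h : (\int[P]_x (tp k.+1 (Y n x))%:E <=
    \int[P]_x ((tp k (Y n x))%:E + B%:E * (\1_E x)%:E))%E.
  under [leRHS]eq_integral do rewrite -EFinM -EFinD.
  apply: le_integral_probability => //.
  - exact: mtp.
  - by apply: measurable_funD; [exact: mtp|apply: measurable_funM].
  - by move=> x; exact: truncated_power_ge0.
  move=> x; rewrite indicE; case: (boolP (x \in E)) => [_|].
    rewrite mulr1; apply: le_trans (truncated_power_le _ _) _.
    by rewrite lerDr truncated_power_ge0.
  rewrite notin_setE /E /= => /negP; rewrite -leNgt => Yk.
  by rewrite mulr0 addr0 (truncated_power_eq Yk) /tp ge_min lexx.
rewrite ge0_integralD// in h; first last.
- by apply/measurable_EFinP; apply: measurable_funM.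
- by move=> x _; rewrite mule_ge0// lee_fin.
- by apply/measurable_EFinP; exact: mtp.
- by move=> x _; rewrite lee_fin truncated_power_ge0.
rewrite ge0_integralZl_EFin// in h; last by apply/measurable_EFinP.
have iE : (\int[P]_x (\1_E x)%:E)%E = (fine (P E))%:E.
  by rewrite integral_indic// setIT fineK// fin_num_measure.
rewrite iE !mfin -EFinM -EFinD lee_fin in h.
apply: le_trans h _; rewrite lerD2l.
apply: le_trans (ler_wpM2l B0 (weak Nn _)) _; first by rewrite exprn_gt0.
rewrite /B exprS powRM ?exprn_ge0// mulrACA -mulrA.
rewrite le_eqVlt; apply/orP; left; apply/eqP.
rewrite /theta -pow2_powR powRB; last by rewrite expf_eq0 pnatr_eq0 andbF implybT.
rewrite powRN; ring.
Qed.

Lemma truncated_moment_bound n k j : (N <= n)%N ->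
  m n (k + j) <= m n k + c * (theta ^+ k - theta ^+ (k + j)).
Proof.
have /andP[t0 t1] := theta_itv.
move=> Nn; elim: j => [|j IHj]; first by rewrite addn0 subrr mulr0 addr0.
rewrite addnS; apply: le_trans (truncated_moment_step (k + j) Nn) _.
have -> : 2 `^ p * A * theta ^+ (k + j) = c * (theta ^+ (k + j) - theta ^+ (k + j).+1).
  by rewrite /c exprS; field; rewrite subr_eq0 gt_eqF.
exact: telescope_step IHj.
Qed.

(** The truncation error is a geometric series, uniformly in [n]. As [Y n] is
    bounded, its moment is itself a truncated moment of some higher order. *)
Lemma moment_truncated n k : (N <= n)%N ->
  exists e : R, [/\ (\int[P]_x (`|Y n x| `^ p)%:E = e%:E)%E, m n k <= e &
    e <= m n k + c * theta ^+ k].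
Proof.
have /andP[t0 t1] := theta_itv.
move=> Nn; have [B HB] := bY n.
pose j := (Num.truncn B).+1.
have Bj : B <= 2 ^+ (k + j).
  apply: le_trans (ltW (truncnS_gt _)) _.
  rewrite -natrX ler_nat; apply: leq_trans (ltnW (ltn_expl _ (ltnSn 1))) _.
  by rewrite leq_exp2l// leq_addl.
exists (m n (k + j)); split.
- rewrite -mfin; apply: eq_integral => x _; congr (_%:E).
  by rewrite truncated_power_eq// (le_trans (HB x)).
- rewrite -lee_fin -!mfin; apply: le_integral_probability.
  + exact: (measurable_truncated_power k (mY n)).
  + exact: (measurable_truncated_power (k + j) (mY n)).
  + by move=> x; exact: truncated_power_ge0.
  + by move=> x; apply: truncated_power_mono; exact: leq_addr.
apply: le_trans (truncated_moment_bound k j Nn) _.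
by rewrite lerD2l ler_wpM2l// gerBl exprn_ge0// ltW.
Qed.

Let z k : R := fine (\int[Q]_w (tp k (Z w))%:E)%E.

Let zfin k : (\int[Q]_w (tp k (Z w))%:E)%E = (z k)%:E.
Proof.
rewrite fineK//; apply: (@integral_bounded_fin _ _ _ _ _ ((2 ^+ k) `^ p)).
  exact: measurable_truncated_power.
by move=> x; rewrite truncated_power_ge0 truncated_power_le.
Qed.

Let m_cvg k : m n k @[n --> \oo] --> z k.
Proof.
have bg : exists M : R, forall x, `|tp k x| <= M.
  exists ((2 ^+ k) `^ p) => x; rewrite ger0_norm ?truncated_power_ge0//.
  exact: truncated_power_le.
have := cvg_bounded_continuous (@continuous_truncated_power k) bg.
by rewrite zfin => /fine_cvgP[].
Qed.

(** The moment of the limit is finite: its truncations inherit a bound that is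
    uniform in the height from those of [Y n]. *)
Lemma truncated_moment_limit : exists2 M : R, 
  (\int[Q]_w (`|Z w| `^ p)%:E = M%:E)%E & z k @[k --> \oo] --> M.
Proof.
have /andP[t0 t1] := theta_itv.
have zM k : z k <= z 0%N + c.
  apply/ler_addgt0Pl => e e0.
  have e20 : 0 < e / 2 by lra.
  have /cvgrPdist_lt /(_ _ e20)[N1 _ H1] := m_cvg (k:=k).
  have /cvgrPdist_lt /(_ _ e20)[N2 _ H2] := m_cvg (k:=0%N).
  pose n := (N + N1 + N2)%N.
  have nN1 : (N1 <= n)%N by rewrite /n -addnA addnCA leq_addr.
  have nN2 : (N2 <= n)%N by rewrite /n leq_addl.
  have nN : (N <= n)%N by rewrite /n -addnA leq_addr.
  have := H1 n nN1; rewrite /= ltr_distl => /andP[_ h2].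
  have := H2 n nN2; rewrite /= ltr_distl => /andP[h3 _].
  have h4 := truncated_moment_bound 0 k nN.
  have h5 : c * (theta ^+ 0 - theta ^+ (0 + k)) <= c.
    by rewrite expr0 ler_piMr// gerBl exprn_ge0// ltW.
  by rewrite add0n in h4 h5; exact: half_error_sum h2 h3 h4 h5.
have mono : (\int[Q]_w (tp k (Z w))%:E @[k --> \oo] -->
    \int[Q]_w (`|Z w| `^ p)%:E)%E.
  have -> : (\int[Q]_w (`|Z w| `^ p)%:E = 
      \int[Q]_w (limn (fun k => (tp k (Z w))%:E)))%E.
    apply: eq_integral => w _; apply/esym/cvg_lim => //.
    apply: cvg_near_cst; exists (Num.truncn `|Z w|).+1 => // k /= kw.
    rewrite truncated_power_eq//.
    apply: le_trans (ltW (truncnS_gt _)) _.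
    rewrite -natrX ler_nat; apply: leq_trans kw _.
    exact: ltnW (ltn_expl _ _).
  apply: (cvg_monotone_convergence (mu := Q) (D := setT)) => //.
  - move=> k; apply/measurable_EFinP; exact: measurable_truncated_power.
  - by move=> k w _; rewrite lee_fin truncated_power_ge0.
  - by move=> w _ k k' kk; rewrite lee_fin truncated_power_mono.
have le_M : (\int[Q]_w (`|Z w| `^ p)%:E <= (z 0%N + c)%:E)%E.
  rewrite -(cvg_lim _ mono)//; apply: lime_le; first by apply/cvg_ex; eexists; exact: mono.
  by apply: nearW => k; rewrite zfin lee_fin.
have Mfin : (\int[Q]_w (`|Z w| `^ p)%:E \is a fin_num)%E.
  rewrite ge0_fin_numE; first by rewrite (le_lt_trans le_M)// ltry.
  by apply: integral_ge0 => w _; rewrite lee_fin powR_ge0.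
exists (fine (\int[Q]_w (`|Z w| `^ p)%:E)%E); first by rewrite fineK.
by move: mono; rewrite -(fineK Mfin) => /fine_cvgP[].
Qed.

(** The weak bound of order [p'] makes the powers of order [p < p'] uniformly
    integrable. *)
Lemma cvg_moments : exists2 M : R, (\int[Q]_w (`|Z w| `^ p)%:E = M%:E)%E &
  (\int[P]_x (`|Y n x| `^ p)%:E @[n --> \oo] --> M%:E)%E.
Proof.
have /andP[t0 t1] := theta_itv.
have [M ZM zM] := truncated_moment_limit.
exists M => //; apply/fine_cvgP; split.
  exists N => // n Nn; have [e [-> _ _]] := moment_truncated 0 Nn.
  by [].
apply/cvgrPdist_lt => e e0; have e40 : 0 < e / 4 by lra.
have /cvg_expr : `|theta| < 1 by rewrite ger0_norm// ltW.
have ec : 0 < e / 4 / (c + 1) by rewrite divr_gt0//; have := c_ge0; lra.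
move=> /cvgrPdist_lt /(_ _ ec)[k1 _ Hk1].
have /cvgrPdist_lt /(_ _ e40)[k2 _ Hk2] := zM.
pose k := (k1 + k2)%N.
have := Hk1 k (leq_addr _ _).
rewrite /= sub0r normrN ger0_norm ?exprn_ge0 ?ltW// ltr_pdivlMr; last first.
  by have := c_ge0; lra.
move=> hk1; have hk2 := Hk2 k (leq_addl _ _).
have /cvgrPdist_lt /(_ _ e40)[n1 _ Hn1] := m_cvg (k := k).
exists (maxn N n1) => // n; rewrite /= geq_max => /andP[Nn n1n].
have [E [-> l u]] := moment_truncated k Nn.
have := Hn1 n n1n; rewrite /= !ltr_distl => /andP[h3 h4].
rewrite /= ltr_distl in hk2; move: hk2 => /andP[h5 h6].
have h7 : c * theta ^+ k <= theta ^+ k * (c + 1).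
  by rewrite mulrDr mulr1 mulrC lerDl exprn_ge0// ltW.
by apply/andP; split; lra.
Qed.

End Convergence.

(** * Moments of the Birkhoff sums *)

Lemma measurable_norm_powR {R : realType} {d : measure_display}
  {U : measurableType d} (V : U -> R) (p : R) : measurable_fun setT V ->
  measurable_fun setT (fun x => `|V x| `^ p).
Proof.
move=> mV.
apply: (@measurableT_comp _ _ _ _ _ _ (fun y : R => y `^ p) _ (fun x => `|V x|)).
  exact: measurable_powR.
by apply: measurableT_comp => //; exact: normr_measurable.
Qed.

Section BirkhoffMoments.
Context {R : realType} {d d' : measure_display} {X : measurableType d}
  {Om : measurableType d'}.
Variables (mu : probability X R) (T : tower X) (rho : R).
Hypothesis hT : young_tower mu T rho.
Variables (q C : R).
Hypotheses (hq : 1 < q) (hC : 0 < C).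
Hypothesis htail : asymp_equiv (tail mu T) (fun n => C * n%:R `^ (- q)).
Variable f : X -> R.
Hypothesis hf : lipschitz_fun T rho f.
Variables (Q : probability Om R) (Z : {RV Q >-> R}).

Local Notation S := (birkhoff_sum T f).
Local Notation a := (normalization q).
Local Notation Y := (fun n x => (a n)^-1 * S n x).

Hypothesis hcvg : cvg_in_distribution mu Y Z.

Lemma critical_exponent_gt0 : 0 < critical_exponent q.
Proof. rewrite /critical_exponent; have q1 := hq; case: ifP => q2; lra. Qed.

Lemma normalization_gt0 : exists N, forall n, (N <= n)%N -> 0 < a n.
Proof.
have [N HN] := normalization_infty hq 1.
by exists N => n /HN; exact: lt_le_trans.
Qed.

Lemma measurable_normalized n : measurable_fun setT (Y n).
Proof.
have [L L0 [fL fLip]] := lipschitz_bound hT hf.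
by apply: measurable_funM => //; exact: (measurable_birkhoff hT L0 fLip).
Qed.

Lemma normalized_bounded n : exists B : R, forall x, `|Y n x| <= B.
Proof.
have [L L0 [fL fLip]] := lipschitz_bound hT hf.
exists (`|(a n)^-1| * (L * n%:R)) => x; rewrite normrM ler_wpM2l//.
exact: birkhoff_le.
Qed.

(** The convergence gives the estimate at the times [m] that are large; at the
    earlier ones the sums are bounded and [a n] is larger. *)
Lemma birkhoff_tight (L : R) (e : R) : 0 < L -> (forall x, `|f x| <= L) ->
  (forall x y, same_level T x y -> `|f x - f y| <= L * tdist T rho x y) ->
  0 < e -> exists2 K0, 0 < K0 & exists N, forall n, (N <= n)%N ->
     forall m, (m <= n)%N -> fine (mu (above (T:=T) f m (K0 * a n))) <= e.
Proof.
move=> L0 fL fLip e0.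
have [K K0 [N1 HN1]] := cvg_in_distribution_tight measurable_normalized hcvg e0.
have [N2 HN2] := normalization_gt0.
pose N3 := maxn N1 N2.
have [N4 HN4] := normalization_infty hq (L * N3%:R / K).
exists K => //; exists (maxn N3 N4) => n; rewrite geq_max => /andP[n3 n4] m mn.
have [mN|Nm] := leqP N3 m.
  have /andP[m1 m2] : (N1 <= m)%N && (N2 <= m)%N by rewrite -geq_max.
  apply: le_trans (HN1 m m1); have am := HN2 m m2.
  apply: le_pr.
  - exact: (measurable_above hT L0 fLip).
  - by apply: measurable_norm_gt; exact: measurable_normalized.
  move=> x; rewrite /above /= => h.
  rewrite normrM ger0_norm ?invr_ge0 ?(ltW am)// mulrC ltr_pdivlMr//.
  by apply: le_lt_trans h; rewrite ler_pM2l// normalization_le.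
rewrite (_ : above f m _ = set0) ?measure0 ?(ltW e0)//.
apply/seteqP; split=> // x; rewrite /above /= => h.
have h1 := birkhoff_le fL (T:=T) m x.
have h2 : L * m%:R <= L * N3%:R by rewrite ler_pM2l// ler_nat ltnW.
have h3 := HN4 n n4; rewrite ler_pdivrMr// in h3.
suff : K * a n < K * a n by rewrite ltxx.
by apply: (lt_le_trans h); apply: (le_trans h1); apply: (le_trans h2); rewrite [leRHS]mulrC.
Qed.

Lemma normalized_weak_type : exists2 A : R, 0 < A & exists N, forall n, (N <= n)%N ->
  forall t, 0 < t -> fine (mu [set x | t < `|Y n x|]) <= A * t `^ (- critical_exponent q).
Proof.
have [L L0 [fL fLip]] := lipschitz_bound hT hf.
have [t1 [K [D [t10 K0 D0 rec]]]] := exceeds_recursion hT L0 fL fLip hq hC htail.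
have [C' C'0 scale] := normalization_scale hq L0.
have mE := measurable_exceeds hT L0 fLip.
have [A A0 [N HN]] : exists2 A, 0 < A & exists N', forall n, (N' <= n)%N ->
    forall t, 0 < t ->
    fine (mu (exceeds (T:=T) f n t)) <= A * (a n / t) `^ critical_exponent q.
  apply: (weak_type_bootstrap (Ab := fun m t => fine (mu (above (T:=T) f m t)))
    _ _ _ t10 K0 D0 critical_exponent_gt0 C'0 rec _ (normalization_infty hq) scale).
  - by move=> n t; rewrite pr_ge0 /=; exact: pr_le1.
  - by move=> n t; exact: exceeds_large.
  - move=> n t t' tt; apply: le_pr; try exact: (measurable_above hT L0 fLip).
    by move=> x; rewrite /above /=; exact: le_lt_trans.
  - by move=> e; exact: (birkhoff_tight L0 fL fLip).
have [N2 HN2] := normalization_gt0.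
exists A => //; exists (maxn N N2) => n; rewrite geq_max => /andP[nN n2] t t0.
have an := HN2 n n2.
have ant : 0 < a n * t by exact: mulr_gt0.
have -> : t `^ (- critical_exponent q) = (a n / (a n * t)) `^ critical_exponent q.
  rewrite invfM mulrA divff ?gt_eqF// mul1r -(powR_inv1 (ltW t0)) -powRrM.
  by rewrite mulN1r.
apply: le_trans (HN n nN _ ant); apply: le_pr => //.
  by apply: measurable_norm_gt; exact: measurable_normalized.
move=> x /= h; exists n => //; rewrite /above /=.
by rewrite normrM ger0_norm ?invr_ge0 ?(ltW an)// mulrC ltr_pdivlMr// mulrC in h.
Qed.

Lemma normalized_moments (p : R) : 0 < p -> p < critical_exponent q ->
  exists2 M : R, (\int[Q]_w (`|Z w| `^ p)%:E = M%:E)%E &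
  (\int[mu]_x (`|Y n x| `^ p)%:E @[n --> \oo] --> M%:E)%E.
Proof.
move=> p0 pp; have [A A0 [N HN]] := normalized_weak_type.
exact: (cvg_moments measurable_normalized hcvg p0 pp A0 normalized_bounded HN).
Qed.

(** A vanishing moment would concentrate the law at zero. *)
Lemma nondegenerate_moment (p M : R) : nondegenerate_rv Z -> 0 < p ->
  (\int[Q]_w (`|Z w| `^ p)%:E = M%:E)%E -> M != 0.
Proof.
move=> hZ p0 ZM; apply/eqP => M0; apply: hZ; exists 0.
have mZ : measurable_fun setT Z by exact: measurable_funP.
have mZp : measurable_fun setT (fun w => (`|Z w| `^ p)%:E).
  by apply/measurable_EFinP; exact: measurable_norm_powR.
have : (\int[Q]_w `|(`|Z w| `^ p)%:E| = 0)%E.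
  rewrite -[RHS]/(0%:E) -M0 -ZM; apply: eq_integral => w _.
  by rewrite gee0_abs// lee_fin powR_ge0.
move/(ae_eq_integral_abs Q measurableT mZp) => ae0.
have m0 : measurable (Z @^-1` [set 0]).
  by rewrite -[_ @^-1` _]setTI; apply: mZ.
have : Q (~` (Z @^-1` [set 0])) = 0.
  apply/negligibleP; first exact: measurableC.
  apply: negligibleS ae0 => w /= Zw h; apply: Zw.
  have /eqP := h Logic.I; rewrite eqe powR_eq0 normr_eq0 => /andP[/eqP //].
rewrite probability_setC// => h; change (Q (Z @^-1` [set 0]) = 1%E).
move: h; rewrite -(fineK (fin_num_measure Q _ m0)) -EFinB => -[h].
by congr (_%:E); lra.
Qed.

Lemma birkhoff_moments (p : R) : nondegenerate_rv Z -> 0 < p -> p < critical_exponent q ->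
  exists2 K : R, K != 0 & asymp_equiv
    (fun n => fine ('E_mu[fun x => (`|S n x| `^ p)%R])%E) (fun n => K * a n `^ p).
Proof.
move=> hZ p0 pp; have [M ZM cvgM] := normalized_moments p0 pp.
have M0 := nondegenerate_moment hZ p0 ZM.
exists M => //; rewrite /asymp_equiv.
have [N HN] := normalization_gt0.
have /fine_cvgP[[N' _ HN'] cvgM'] := cvgM.
have : M^-1 * fine (\int[mu]_x (`|Y n x| `^ p)%:E)%E @[n --> \oo] --> M^-1 * M.
  exact: cvgMr.
rewrite mulVf//; apply: cvg_trans; apply: near_eq_cvg.
exists (maxn N N') => // n /=; rewrite geq_max => /andP[Nn N'n]; have an := HN n Nn.
have ap : 0 < a n `^ p by rewrite powR_gt0.
rewrite unlock.
have -> : (\int[mu]_x (`|S n x| `^ p)%:E =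
    (a n `^ p)%:E * \int[mu]_x (`|Y n x| `^ p)%:E)%E.
  rewrite -ge0_integralZl_EFin ?(ltW ap)//.
  - apply: eq_integral => x _; rewrite -EFinM; congr (_%:E).
    rewrite -powRM ?(ltW an)// normrM ger0_norm ?invr_ge0 ?(ltW an)//.
    by rewrite mulrA divff ?gt_eqF// mul1r.
  apply/measurable_EFinP; apply: measurable_norm_powR.
  exact: measurable_normalized.
rewrite fineM ?HN'//=.
by field; rewrite M0 gt_eqF.
Qed.

End BirkhoffMoments.

Unset Implicit Arguments.
Set Strict Implicit.
Set Printing Implicit Defensive.

Theorem corollary1p5
  (R : realType) (d : measure_display) (X : measurableType d)
  (mu : probability X R) (T : tower X) (rho : R)
  (hT : young_tower mu T rho)
  (q C : R) (hq : 1 < q) (hC : 0 < C)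
  (htail : asymp_equiv (tail mu T) (fun n => C * n%:R `^ (- q)))
  (f : X -> R) (hf : lipschitz_fun T rho f) (hf0 : ('E_mu[f] = 0)%E)
  (d' : measure_display) (Om : measurableType d') (Q : probability Om R)
  (Z : {RV Q >-> R})
  (hcvg : cvg_in_distribution mu
     (fun n x => (normalization q n)^-1 * birkhoff_sum T f n x) Z)
  (hZ : nondegenerate_rv Z)
  (hgauss : 2 <= q -> gaussian Z)
  (hstable : q < 2 -> stable_law q Z) :
  (forall p : R, 0 < p -> p < critical_exponent q ->
     ('E_mu[fun x => (`|(normalization q n)^-1 * birkhoff_sum T f n x| `^ p)%R]
        @[n --> \oo] --> 'E_Q[fun w => (`|Z w| `^ p)%R])%E)
  /\
  [/\ 2 < q -> forall p : R, 0 < p -> p < 2 * q - 2 ->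
        exists2 K : R, K != 0 & asymp_equiv
          (fun n => fine ('E_mu[fun x => (`|birkhoff_sum T f n x| `^ p)%R])%E)
          (fun n => K * n%:R `^ (p / 2)),
      q = 2 -> forall p : R, 0 < p -> p < 2 ->
        exists2 K : R, K != 0 & asymp_equiv
          (fun n => fine ('E_mu[fun x => (`|birkhoff_sum T f n x| `^ p)%R])%E)
          (fun n => K * (n%:R * ln n%:R) `^ (p / 2))
    & q < 2 -> forall p : R, 0 < p -> p < q ->
        exists2 K : R, K != 0 & asymp_equiv
          (fun n => fine ('E_mu[fun x => (`|birkhoff_sum T f n x| `^ p)%R])%E)
          (fun n => K * n%:R `^ (p / q))].
Proof.
split=> [p p0 pp|].
  have [M ZM cvgM] := normalized_moments hT hq hC htail hf hcvg p0 pp.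
  by rewrite unlock ZM.
have H := birkhoff_moments hT hq hC htail hf hcvg.
split=> [q2|q2|q2] p p0 pp.
- have pc : p < critical_exponent q by rewrite /critical_exponent (ltW q2).
  have [K K0 HK] := H p hZ p0 pc; exists K => //.
  rewrite (_ : (fun n => _ * _) = fun n => K * normalization q n `^ p)//.
  by apply/funext => n; rewrite /normalization q2 -powRrM [_^-1 * _]mulrC.
- have pc : p < critical_exponent q by rewrite /critical_exponent q2 lexx; lra.
  have [K K0 HK] := H p hZ p0 pc; exists K => //.
  rewrite (_ : (fun n => _ * _) = fun n => K * normalization q n `^ p)//.
  by apply/funext => n; rewrite /normalization q2 ltxx eqxx -powRrM [_^-1 * _]mulrC.
- have pc : p < critical_exponent q by rewrite /critical_exponent leNgt q2.
  have [K K0 HK] := H p hZ p0 pc; exists K => //.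
  rewrite (_ : (fun n => _ * _) = fun n => K * normalization q n `^ p)//.
  apply/funext => n; rewrite /normalization ltNge (ltW q2) /= lt_eqF//.
  by rewrite -powRrM [_^-1 * _]mulrC.
Qed.
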